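(* Let $p\ge1$, $n\ge2$, $m\ge0$ be integers and let $\zeta\in\widehat{S}_p$. Then the Poisson kernel $P_p(x,\zeta)$ and the zonal polyharmonic $Z_m^p(x,\zeta)$ are expressed by the Gegenbauer polynomials as follows: for $x\in\widehat{B}_p$, $$P_p(x,\zeta)=(1-|x|^{2p})\sum_{m=0}^{\infty}C^{n/2}_m\Big(\frac{x\cdot\overline{\zeta}}{|x||\overline{\zeta}|}\Big)|x|^m|\overline{\zeta}|^m,$$ and for $x\in\mathbb{C}^n$, $$Z^p_m(x,\zeta)=\Big[C^{n/2}_m\Big(\frac{x\cdot\overline{\zeta}}{|x||\overline{\zeta}|}\Big)-C^{n/2}_{m-2p}\Big(\frac{x\cdot\overline{\zeta}}{|x||\overline{\zeta}|}\Big)\Big]|x|^m|\overline{\zeta}|^m,$$ and in consequence also $$Z_m^p(x,\zeta)=\sum_{k=0}^{[m/2]}(-1)^k\frac{n(n+2)\cdots(n+2m-2p-2k-2)}{k!\,2^k(m-2k)!}\Big[(n+2(m-p-k))\cdots(n+2(m-k-1))-(-1)^p\,2(k-p+1)\cdots2k\Big](x\cdot\overline{\zeta})^{m-2k}|x|^{2k}|\overline{\zeta}|^{2k}.$$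
   Context: $B$ and $S$ are the open Euclidean unit ball and the unit sphere in $\mathbb{R}^n\subset\mathbb{C}^n$ centred at the origin; $\sigma$ is the normalised surface measure on $S$; $\widehat{B}_p:=\bigcup_{k=0}^{p-1}e^{\frac{k\pi i}{p}}B$ and $\widehat{S}_p:=\bigcup_{k=0}^{p-1}e^{\frac{k\pi i}{p}}S$ in $\mathbb{C}^n$. For $z,w\in\mathbb{C}^n$: $z\cdot w=\sum_jz_jw_j$ (bilinear), $z^2=z\cdot z$, $|z|=(\sum_jz_j^2)^{1/2}$ with the principal square root (so $|z|^{2k}=(z^2)^k$), and $\overline{\zeta}$ is the componentwise conjugate. The Poisson kernel for $\widehat{B}_p$ is $P_p(x,\zeta)=\dfrac{1-|x|^{2p}}{(x^2\overline{\zeta}^2-2x\cdot\overline{\zeta}+1)^{n/2}}$ for $x\in\widehat{B}_p$, $\zeta\in\widehat{S}_p$ (principal branch of the power). $\mathcal{H}_m^p(\mathbb{C}^n)$ is the space of complex polynomials $u$ on $\mathbb{C}^n$, homogeneous of degree $m$, with $\Delta^pu=0$, $\Delta=\sum_j\partial^2/\partial x_j^2$; $\mathcal{H}_m^p(\widehat{S}_p)$ is the space of their restrictions to $\widehat{S}_p$, with inner product $\langle f,g\rangle_{\widehat{S}_p}:=\frac1p\int_S\sum_{j=0}^{p-1}f(e^{\frac{j\pi i}{p}}\xi)\overline{g(e^{\frac{j\pi i}{p}}\xi)}\,d\sigma(\xi)$. For $\zeta\in\widehat{S}_p$ the zonal polyharmonic $Z_m^p(\cdot,\zeta)$ is the unique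 element of $\mathcal{H}_m^p(\widehat{S}_p)$ with $q(\zeta)=\langle q,Z_m^p(\cdot,\zeta)\rangle_{\widehat{S}_p}$ for all $q\in\mathcal{H}_m^p(\widehat{S}_p)$; for $x\in\mathbb{C}^n$, $Z_m^p(x,\zeta)$ is the value at $x$ of the unique polynomial in $\mathcal{H}_m^p(\mathbb{C}^n)$ restricting to it. The Gegenbauer polynomial of order $\lambda>-\frac12$ and degree $m$ is $C^\lambda_m(t)=\sum_{k=0}^{[m/2]}(-1)^k\frac{\Gamma(m+\lambda-k)}{k!(m-2k)!\Gamma(\lambda)}(2t)^{m-2k}$, with $C^\lambda_m\equiv0$ for $m<0$. Conventions: expressions $C^{\lambda}_l\big(\frac{x\cdot\overline\zeta}{|x||\overline\zeta|}\big)|x|^m|\overline\zeta|^m$ (with $l\le m$, $m-l$ even) are polynomials in $x\cdot\overline\zeta$ and $|x|^2|\overline\zeta|^2$, and are understood in this sense when $|x|=0$. In the last formula, $n(n+2)\cdots(n+2m-2p-2k-2)$ has $m-p-k$ factors (equal to $1$ if $m-p-k=0$), $(n+2(m-p-k))\cdots(n+2(m-k-1))$ has $p$ factors increasing by $2$, and $2(k-p+1)\cdots2k=2^p(k-p+1)(k-p+2)\cdots k$ (which is $0$ for $0\le k\le p-1$). When $m-k<p$, the product of $n(n+2)\cdots(n+2m-2p-2k-2)$ with the square bracket is understood as $n(n+2)\cdots(n+2(m-k-1))$ (equal to $1$ if $m-k=0$). *)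

(* Defs.v *)
From HB Require Import structures.
From mathcomp Require Import all_boot all_order all_algebra.
From mathcomp Require Import all_classical all_reals all_analysis.
From mathcomp Require Import measurable_realfun complex.
(* Only the canonical structures of mpoly are imported, as its notations clash
   with those of mathcomp-analysis. *)
From mathcomp Require mpoly.
Import (canonicals) mpoly.

Set Implicit Arguments.
Unset Strict Implicit.
Unset Printing Implicit Defensive.

Import Order.TTheory GRing.Theory Num.Theory.
Import numFieldNormedType.Exports.

Local Open Scope classical_set_scope.
Local Open Scope ring_scope.
Local Open Scope complex_scope.

(* Points of R^n are [n.-tuple R], which carries the product
   sigma-algebra; points of C^n are row vectors over R[i]. *)

Definition sqnorm (R : realType) (n : nat) (t : n.-tuple R) : R :=
  \sum_(j < n) tnth t j ^+ 2.

Definition real_ball (R : realType) (n : nat) : set (n.-tuple R) :=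
  [set t | sqnorm t < 1].
Arguments real_ball : clear implicits.

Definition real_sphere (R : realType) (n : nat) : set (n.-tuple R) :=
  [set t | sqnorm t = 1].
Arguments real_sphere : clear implicits.

Definition normalize (R : realType) (n : nat) (t : n.-tuple R) : n.-tuple R :=
  [tuple tnth t j / Num.sqrt (sqnorm t) | j < n].

Section lebesgue_cons.
Variables (R : realType) (n : nat).
Variable mu : {sigma_finite_measure set (n.-tuple R) -> \bar R}.

Let f (u : measurableTypeR R * n.-tuple R) : n.+1.-tuple R :=
  [tuple of u.1 :: u.2].

Let mf : measurable_fun setT f.
Proof. exact: measurable_cons. Qed.

Definition lebesgue_cons : set (n.+1.-tuple R) -> \bar R :=
  pushforward (lebesgue_measure \x mu)%E f.

Let cons0 : lebesgue_cons set0 = 0%E.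
Proof. by rewrite /lebesgue_cons /pushforward preimage_set0 measure0. Qed.

Let cons_ge0 A : (0 <= lebesgue_cons A)%E.
Proof. exact: measure_ge0. Qed.

Let cons_sigma_additive : semi_sigma_additive lebesgue_cons.
Proof.
pose nu : {measure set (n.+1.-tuple R) -> \bar R} :=
  measure_function_pushforward__canonical__measure_function_Measure
    (lebesgue_measure \x mu)%E mf.
exact: (@measure_semi_sigma_additive _ _ _ nu).
Qed.

HB.instance Definition _ := isMeasure.Build _ _ _ lebesgue_cons
  cons0 cons_ge0 cons_sigma_additive.

Let cons_sigma_finite : sigma_finite setT lebesgue_cons.
Proof.
have /sigma_finiteP[F [TF ndF Foo]] := sigma_finiteT (@lebesgue_measure R).
have /sigma_finiteP[G [TG ndG Goo]] := sigma_finiteT mu.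
pose g (t : n.+1.-tuple R) : measurableTypeR R * n.-tuple R :=
  (thead t, [tuple of behead t]).
have mg : measurable_fun setT g.
  apply/measurable_fun_pairP; split; first exact: measurable_tnth.
  exact: measurable_behead.
have fK : cancel f g.
  by move=> [x t]; rewrite /g /f /= theadE; congr pair; exact/val_inj.
exists (fun i => g @^-1` (F i `*` G i)) => [|i].
  apply/esym/seteqP; split => // t _.
  have [i _ Fi] : (\bigcup_i F i) (g t).1 by rewrite -TF.
  have [k _ Gk] : (\bigcup_i G i) (g t).2 by rewrite -TG.
  exists (maxn i k) => //; split => /=.
  - by move: Fi; exact/subsetPset/ndF/leq_maxl.
  - by move: Gk; exact/subsetPset/ndG/leq_maxr.
have [mFi Fioo] := Foo i; have [mGi Gioo] := Goo i; split.
  by rewrite -[X in measurable X]setTI; apply: mg => //; exact: measurableX.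
rewrite /lebesgue_cons /pushforward -comp_preimage.
rewrite (_ : g \o f = id) ?preimage_id; last by apply/funext => u; exact: fK.
by rewrite product_measure1E// lte_mul_pinfty// ge0_fin_numE.
Qed.

HB.instance Definition _ := Measure_isSigmaFinite.Build _ _ _ lebesgue_cons
  cons_sigma_finite.

End lebesgue_cons.

Fixpoint lebesgue_tuple (R : realType) (n : nat) :
    {sigma_finite_measure set (n.-tuple R) -> \bar R} :=
  if n is n'.+1 then lebesgue_cons (lebesgue_tuple R n') else \d_[tuple].
Arguments lebesgue_tuple : clear implicits.

Lemma measurable_sqnorm (R : realType) (n : nat) :
  measurable_fun setT (@sqnorm R n).
Proof.
apply: measurable_sum => j; apply: measurable_funX; exact: measurable_tnth.
Qed.

Lemma measurable_real_ball (R : realType) (n : nat) :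
  measurable (real_ball R n).
Proof.
rewrite (_ : real_ball R n = @sqnorm R n @^-1` `]-oo, 1[); last first.
  by apply/seteqP; split => t /=; rewrite in_itv.
by rewrite -[X in measurable X]setTI; exact: measurable_sqnorm.
Qed.

Lemma measurable_normalize (R : realType) (n : nat) :
  measurable_fun setT (@normalize R n).
Proof.
apply/measurable_fun_tnthP => i.
rewrite (_ : _ \o _ =
    fun t => tnth t i * (Num.sqrt (sqnorm t) `^ (-1))); last first.
  by apply/funext => t; rewrite /= tnth_mktuple powR_inv1// sqrtr_ge0.
apply: measurable_funM; first exact: measurable_tnth.
apply: (@measurableT_comp _ _ _ _ _ _ (@powR R ^~ (-1))) => //=.
apply: (@measurableT_comp _ _ _ _ _ _ (@Num.sqrt R)); last first.
  exact: measurable_sqnorm.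
by apply: continuous_measurable_fun; exact: sqrt_continuous.
Qed.

HB.instance Definition _ (R : realType) (n : nat) :=
  isMeasurableFun.Build _ _ _ _ (@normalize R n) (@measurable_normalize R n).

(* Cone measure on the sphere: up to the factor n, the surface measure of A is
   the volume of the cone {r xi | 0 < r < 1, xi \in A}.  The origin, which
   [normalize] fixes, is a null set for n > 0. *)
Definition cone_measure (R : realType) (n : nat) :
    set (n.-tuple R) -> \bar R :=
  pushforward (mrestr (lebesgue_tuple R n) (@measurable_real_ball R n))
    (@normalize R n).
Arguments cone_measure : clear implicits.

HB.instance Definition _ (R : realType) (n : nat) :=
  Measure.copy (cone_measure R n)
    (measure_function_pushforward__canonical__measure_function_Measure
       (mrestr (lebesgue_tuple R n) (@measurable_real_ball R n))
       (@measurable_normalize R n)).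

(* Normalised surface measure; the second argument of [mnormalize] is its
   default value for measures of total mass 0 or +oo, which does not occur. *)
Definition sphere_measure (R : realType) (n : nat) : probability (n.-tuple R) R :=
  mnormalize (cone_measure R n) (\d_([tuple 0 | _ < n] : n.-tuple R)).
Arguments sphere_measure : clear implicits.

Definition sphere_integral (R : realType) (n : nat) (f : n.-tuple R -> R[i]) :
    R[i] :=
  (\int[sphere_measure R n]_(xi in real_sphere R n) complex.Re (f xi)) +i*
  (\int[sphere_measure R n]_(xi in real_sphere R n) complex.Im (f xi)).

Definition embed (R : realType) (n : nat) (t : n.-tuple R) : 'rV[R[i]]_n :=
  \row_j (tnth t j)%:C.

(* exp(k pi i / p) *)
Definition rot (R : realType) (p k : nat) : R[i] :=
  cos (k%:R * pi / p%:R) +i* sin (k%:R * pi / p%:R).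

Definition Bhat (R : realType) (p n : nat) : set 'rV[R[i]]_n :=
  [set x | exists2 k : nat, (k < p)%N &
     exists2 b, real_ball R n b & x = rot R p k *: embed b].
Arguments Bhat : clear implicits.

Definition Shat (R : realType) (p n : nat) : set 'rV[R[i]]_n :=
  [set x | exists2 k : nat, (k < p)%N &
     exists2 b, real_sphere R n b & x = rot R p k *: embed b].
Arguments Shat : clear implicits.

Definition cdot (R : realType) (n : nat) (z w : 'rV[R[i]]_n) : R[i] :=
  \sum_(j < n) z 0 j * w 0 j.

(* [sqrtc] is the principal square root, unlike [sqrtC], whose values lie in
   the closed upper half-plane. *)
Definition cabs (R : realType) (n : nat) (z : 'rV[R[i]]_n) : R[i] :=
  sqrtc (cdot z z).

Definition cconj (R : realType) (n : nat) (z : 'rV[R[i]]_n) : 'rV[R[i]]_n :=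
  map_mx conjc z.

Definition cmod (R : realType) (z : R[i]) : R :=
  Num.sqrt (complex.Re z ^+ 2 + complex.Im z ^+ 2).

(* Principal argument, in ]-pi, pi]. *)
Definition carg (R : realType) (z : R[i]) : R :=
  if 0 <= complex.Im z then acos (complex.Re z / cmod z)
  else - acos (complex.Re z / cmod z).

(* Principal branch of z^a = exp(a Log z). *)
Definition cpow (R : realType) (z : R[i]) (a : R) : R[i] :=
  (cmod z `^ a)%:C * (cos (a * carg z) +i* sin (a * carg z)).

Definition poisson (R : realType) (p n : nat) (x zeta : 'rV[R[i]]_n) : R[i] :=
  (1 - cabs x ^+ (2 * p)) /
  cpow (cdot x x * cdot (cconj zeta) (cconj zeta)
        - 2%:R * cdot x (cconj zeta) + 1) (n%:R / 2%:R).

Definition laplacian (R : realType) (n : nat) (u : mpoly.mpoly n R[i]) :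
    mpoly.mpoly n R[i] :=
  \sum_(j < n) mpoly.mderiv j (mpoly.mderiv j u).

Definition polyharmonic (R : realType) (p m n : nat) :
    set (mpoly.mpoly n R[i]) :=
  [set u | u \is mpoly.ishomog1 m (mpoly.Measure.clone n (@mpoly.mdeg n) _) /\
           iter p (@laplacian R n) u = 0].
Arguments polyharmonic : clear implicits.

(* Functions on Shat are total functions on C^n that vanish outside Shat. *)
Definition restrict_Shat (R : realType) (p n : nat)
    (u : mpoly.mpoly n R[i]) : 'rV[R[i]]_n -> R[i] :=
  patch (fun=> 0) (Shat R p n) (fun x => mpoly.meval (x 0) u).

Definition sphere_polyharmonic (R : realType) (p m n : nat) :
    set ('rV[R[i]]_n -> R[i]) :=
  [set f | exists2 u, polyharmonic R p m n u & f = restrict_Shat p u].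
Arguments sphere_polyharmonic : clear implicits.

Definition Shat_inner (R : realType) (p n : nat) (f g : 'rV[R[i]]_n -> R[i]) :
    R[i] :=
  p%:R^-1 * sphere_integral (fun xi : n.-tuple R =>
    \sum_(j < p) f (rot R p j *: embed xi) * (g (rot R p j *: embed xi))^*).

Definition zonal_sphere (R : realType) (p m n : nat) (zeta : 'rV[R[i]]_n) :
    'rV[R[i]]_n -> R[i] :=
  xget (fun=> 0) [set Z | sphere_polyharmonic R p m n Z /\
    forall q, sphere_polyharmonic R p m n q -> q zeta = Shat_inner p q Z].

Definition zonal_poly (R : realType) (p m n : nat) (zeta : 'rV[R[i]]_n) :
    mpoly.mpoly n R[i] :=
  xget 0 [set u | polyharmonic R p m n u /\
                  restrict_Shat p u = zonal_sphere p m zeta].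

(* Z_m^p(x, zeta) *)
Definition zonal (R : realType) (p m n : nat) (x zeta : 'rV[R[i]]_n) : R[i] :=
  mpoly.meval (x 0) (zonal_poly p m zeta).

(* Euler's integral for s > 0, continued by Gamma(s) = Gamma(s+1)/s to
   -1 < s < 0, as orders lambda > -1/2 require. *)
Definition Gamma (R : realType) (s : R) : R :=
  let euler (a : R) :=
    \int[@lebesgue_measure R]_(t in `]0, +oo[) (t `^ (a - 1) * expR (- t)) in
  if 0 < s then euler s else euler (s + 1) / s.

Definition gegenbauer_coef (R : realType) (lam : R) (m k : nat) : R :=
  (-1) ^+ k * Gamma (m%:R + lam - k%:R) /
  ((k`!)%:R * ((m - 2 * k)`!)%:R * Gamma lam).

Definition gegenbauer (R : realType) (lam : R) (m : int) (t : R[i]) : R[i] :=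
  match m with
  | Posz m => \sum_(0 <= k < (m./2).+1)
                (gegenbauer_coef lam m k)%:C * (2%:R * t) ^+ (m - 2 * k)
  | Negz _ => 0
  end.

(* C^lam_l (x.w / (|x||w|)) |x|^m |w|^m for l <= m with m - l even; when
   |x||w| = 0 it stands for its expansion as a polynomial in x.w and
   |x|^2|w|^2 = (x.x)(w.w). *)
Definition gegenbauer_term (R : realType) (n : nat) (lam : R) (l : int)
    (m : nat) (x w : 'rV[R[i]]_n) : R[i] :=
  if cabs x * cabs w == 0 then
    match l with
    | Posz l => \sum_(0 <= k < (l./2).+1)
        (gegenbauer_coef lam l k)%:C * (2%:R * cdot x w) ^+ (l - 2 * k)
        * (cdot x x * cdot w w) ^+ ((m - l)./2 + k)
    | Negz _ => 0
    end
  else gegenbauer lam l (cdot x w / (cabs x * cabs w))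
       * cabs x ^+ m * cabs w ^+ m.

(* The k-th coefficient of the explicit formula, up to (-1)^k/(k! 2^k (m-2k)!):
   n(n+2)...(n+2m-2p-2k-2) times the square bracket, and
   n(n+2)...(n+2(m-k-1)) when m - k < p. *)
Definition zonal_coef (R : realType) (p n m k : nat) : R :=
  if (p <= m - k)%N then
    (\prod_(0 <= i < m - p - k) (n%:R + 2%:R * i%:R)) *
    ((\prod_(0 <= i < p) (n%:R + 2%:R * (m - p - k + i)%:R))
     - (-1) ^+ p * \prod_(0 <= i < p) (2%:R * (k%:R - p%:R + 1 + i%:R)))
  else \prod_(0 <= i < m - k) (n%:R + 2%:R * i%:R).

(* Main.v *)
Require Import Defs.
From HB Require Import structures.
From mathcomp Require Import all_boot all_order all_algebra.
From mathcomp Require Import all_classical all_reals all_analysis.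
From mathcomp Require Import complex.
From mathcomp Require Import measurable_realfun.
From mathcomp Require Import ring lra zify.
From mathcomp Require mpoly.
Import (canonicals, coercions) mpoly.

Set Implicit Arguments.
Unset Strict Implicit.
Unset Printing Implicit Defensive.

Import Order.TTheory GRing.Theory Num.Theory.
Import numFieldNormedType.Exports.

Local Open Scope classical_set_scope.
Local Open Scope ring_scope.
Local Open Scope complex_scope.

(** Put [s = x . w] and [P = (x . x) (w . w)] with [w] the conjugate of [zeta].
    All three formulas are about the polynomials [gsum n m s P], the homogeneous
    form of the Gegenbauer polynomial of degree [m] and order [n / 2].

    Zonal polyharmonics. The surface measure enters through three properties
    only ([spherical_mean]): the mean of 1 is 1, a factor [x . x] does not change
    a mean, and the generators [x_i d_j - x_j d_i] of rotations have mean zero.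
    The last one holds because the cone measure is invariant under rotations in
    coordinate planes: such a rotation is a product of three shears, and a shear
    preserves Lebesgue measure by Fubini's theorem. Together they express the
    mean of a derivative by a mean in higher degree ([mean_mderiv]), and so they
    determine all moments. Two consequences carry the proof. The solid
    Gegenbauer polynomial with pole [w] reproduces at [w] every homogeneous
    polynomial of degree [m] ([mean_gpoly]), and a polyharmonic polynomial of
    order [p] and degree [m] is orthogonal to all homogeneous polynomials of
    degree [m - 2 p] ([mean_polyharmonic_ortho]). Hence subtracting
    [P ^ p * gsum n (m - 2 p) s P] leaves the reproducing property intact on
    polyharmonic polynomials; and it makes the kernel itself polyharmonic, because
    the difference telescopes into products of powers of [x . x] with harmonic
    polynomials ([polyharmonic_zpoly]). On the union of the rotated spheres the
    phases cancel by homogeneity ([Shat_innerE]), so this kernel is the zonal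
    polyharmonic ([zonalE]).

    Poisson kernel. One has [1 - 2 s t + P t^2 = (1 - z1 t) (1 - z2 t)] with
    [z1] and [z2] of modulus less than 1 ([poisson_roots]), and the series to be
    summed is the expansion of the power [- n / 2] of this quadratic at [t = 1].
    Let [apoly N z] be the truncation of [(1 - z t) ^ (- 1 / 2)]. A differential
    equation shows that the [n]-th power of [apoly N z1 * apoly N z2] has the
    coefficients [gsum n d s P] for [d < N] ([coef_gpow]); the higher
    coefficients add up to little, by comparison with a geometric series
    ([gpow_tail]). The squares of the truncations at [t = 1] tend to
    [1 / (1 - z)], and they stay where only one square root is possible
    ([cvg_apoly]). The limit is the principal power because the product of the
    two square roots lies in the right half-plane ([cvg_gsum_cpow], [cpow_sqr]).

    Coefficients. Integration by parts in Euler's integral turns the quotients of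
    Gamma values at half-integers into the products [n (n + 2) ...]
    ([Gamma_half_rise], [gegenbauer_coefE]), and the explicit formula compares
    the coefficients of the two terms of the zonal polyharmonic
    ([gcoef_zonal_coef]). *)

(** * Polynomials in several variables: homogeneity and the Laplacian *)

Local Notation "'MP' n F" := (mpoly.mpoly n F) (at level 10, n, F at level 9).
Local Notation vX j := (mpoly.mpolyX _ (mpoly.mnm1 j)).
Local Notation hom n d :=
  (mpoly.ishomog1 d (mpoly.Measure.clone n (@mpoly.mdeg n) _)).

Section Homogeneous.
Variables (F : comNzRingType) (n : nat).
Implicit Types p q : MP n F.

Lemma mderiv_vX (i j : 'I_n) :
  mpoly.mderiv i (vX j : MP n F) = (i == j)%:R.
Proof.
rewrite mpoly.mderivX mpoly.mnm1E eq_sym; case: eqP => [->|_]; last first.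
  by rewrite scale0r.
rewrite scale1r -mpoly.mpolyX0; congr mpoly.mpolyX.
by apply/mpoly.mnmP => k; rewrite mpoly.mnmBE mpoly.mnm0E subnn.
Qed.

Lemma hom_vX (j : 'I_n) : (vX j : MP n F) \is hom n 1%N.
Proof. by rewrite mpoly.dhomogX; apply/eqP; exact: mpoly.mdeg1. Qed.

Lemma hom_mderiv d (j : 'I_n) p :
  p \is hom n d -> mpoly.mderiv j p \is hom n d.-1.
Proof.
move=> hp; apply/mpoly.dhomogP => m; rewrite mpoly.mcoeff_msupp.
rewrite mpoly.mcoeff_mderiv => nz.
suff <- : mpoly.mdeg (mpoly.mnm_add m (mpoly.mnm1 j)) = d.
  by rewrite mpoly.mdegD mpoly.mdeg1 addn1.
apply/eqP/negPn/negP => dm; move: nz.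
by rewrite (mpoly.dhomog_nemf_coeff hp)// mul0rn eqxx.
Qed.

Lemma mderiv_hom0 (j : 'I_n) p : p \is hom n 0%N -> mpoly.mderiv j p = 0.
Proof.
move=> hp; apply/mpoly.mpolyP => m; rewrite mpoly.mcoeff_mderiv mpoly.mcoeff0.
rewrite (mpoly.dhomog_nemf_coeff hp) ?mul0rn//.
by rewrite /= mpoly.mdegD mpoly.mdeg1 addn1.
Qed.

Lemma euler d p : p \is hom n d ->
  \sum_(j < n) vX j * mpoly.mderiv j p = p *+ d.
Proof.
move=> hp; rewrite /mpoly.mderiv [in RHS](mpoly.mpolyE p) -sumrMnl.
under eq_bigr do rewrite mulr_sumr.
rewrite exchange_big /= !big_seq; apply: eq_bigr => m mp.
have <- : mpoly.mdeg m = d by exact: (mpoly.dhomog_mf hp).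
rewrite mpoly.mdegE -sumrMnr; apply: eq_bigr => j _.
rewrite -scalerAr -mpoly.mpolyXD mulr_natl -scalerMnl.
have [->|m0] := eqVneq (m j) 0%N; first by rewrite !mulr0n.
congr (_ *: mpoly.mpolyX _ _ *+ _); apply/mpoly.mnmP => k.
rewrite mpoly.mnmDE mpoly.mnmBE subnKC// mpoly.mnm1E.
by case: eqP => // <-; rewrite lt0n.
Qed.

End Homogeneous.

Section Laplacian.
Variables (F : comNzRingType) (n : nat).
Implicit Types f g : MP n F.
Implicit Types w : 'I_n -> F.

Definition lap f : MP n F :=
  \sum_(j < n) mpoly.mderiv j (mpoly.mderiv j f).

Definition rho : MP n F := \sum_(j < n) vX j ^+ 2.

Definition lin w : MP n F := \sum_(j < n) w j *: vX j.

Definition qf w : F := \sum_(j < n) w j ^+ 2.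

Definition dirder w f : MP n F := \sum_(j < n) w j *: mpoly.mderiv j f.

Fact lap_is_linear : linear lap.
Proof.
move=> c f g; rewrite /lap scaler_sumr -big_split /=; apply: eq_bigr => j _.
by rewrite !linearP.
Qed.
HB.instance Definition _ :=
  GRing.isLinear.Build F (MP n F) (MP n F) _ lap lap_is_linear.

Lemma hom_rho : rho \is hom n 2%N.
Proof.
by apply: rpred_sum => j _; exact: (mpoly.dhomogMn 2 (hom_vX F j)).
Qed.

Lemma hom_lin w : lin w \is hom n 1%N.
Proof. by apply: rpred_sum => j _; apply: rpredZ; exact: hom_vX. Qed.

Lemma mderiv_lin (i : 'I_n) w : mpoly.mderiv i (lin w) = (w i)%:A.
Proof.
rewrite /lin linear_sum /= (bigD1 i)//= big1 ?addr0 => [|j ji].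
  by rewrite linearZ /= mderiv_vX eqxx.
by rewrite linearZ /= mderiv_vX eq_sym (negbTE ji) scaler0.
Qed.

Lemma mderivXn (i : 'I_n) f k :
  mpoly.mderiv i (f ^+ k) = (f ^+ k.-1 * mpoly.mderiv i f) *+ k.
Proof.
elim: k => [|k IH]; first by rewrite expr0 mulr0n mderiv_hom0// mpoly.dhomog1.
rewrite exprS mpoly.mderivM IH /= mulrnAr mulrA -exprS.
case: k {IH} => [|k]; first by rewrite !expr0 mulr1 mul1r mulr0n addr0 mulr1n.
by rewrite /= [X in X + _]mulrC -mulrS.
Qed.

Lemma mderiv_rho (i : 'I_n) : mpoly.mderiv i rho = vX i *+ 2.
Proof.
rewrite /rho linear_sum /= (bigD1 i)//= big1 ?addr0 => [|j ji].
  by rewrite mderivXn mderiv_vX eqxx mulr1 expr1.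
by rewrite mderivXn mderiv_vX eq_sym (negbTE ji) mulr0 mul0rn.
Qed.

Lemma lapM f g : lap (f * g) =
  lap f * g + (\sum_(j < n) mpoly.mderiv j f * mpoly.mderiv j g) *+ 2
  + f * lap g.
Proof.
rewrite /lap mulr_suml mulr_sumr -sumrMnl -!big_split /=; apply: eq_bigr => j _.
rewrite mpoly.mderivM linearD /= !mpoly.mderivM; ring.
Qed.

Lemma lap_rho : lap rho = (2 * n)%:R.
Proof.
rewrite /lap; under eq_bigr do rewrite mderiv_rho linearMn /= mderiv_vX eqxx.
by rewrite big_const_ord iter_addr_0 -mulrnA.
Qed.

Lemma lap_rhoM d f : f \is hom n d ->
  lap (rho * f) = f *+ (2 * n + 4 * d) + rho * lap f.
Proof.
move=> hf; rewrite lapM lap_rho.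
have -> : \sum_(j < n) mpoly.mderiv j rho * mpoly.mderiv j f = f *+ d *+ 2.
  rewrite -(euler hf) -sumrMnl; apply: eq_bigr => j _.
  by rewrite mderiv_rho mulrnAl.
by congr (_ + _); rewrite mulr_natl -!mulrnA -mulrnDr; congr (_ *+ _); lia.
Qed.

Lemma hom_lap d f : f \is hom n d -> lap f \is hom n d.-2.
Proof. by move=> hf; apply: rpred_sum => j _; do 2! apply: hom_mderiv. Qed.

Lemma lap_hom1 d f : f \is hom n d -> (d <= 1)%N -> lap f = 0.
Proof.
move=> hf d1; rewrite /lap big1 // => j _; apply: mderiv_hom0.
by have := hom_mderiv j hf; case: d hf d1 => [|[|]].
Qed.

Lemma hom_dirder d w f : f \is hom n d -> dirder w f \is hom n d.-1.
Proof.
by move=> hf; apply: rpred_sum => j _; apply: rpredZ; exact: hom_mderiv.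
Qed.

Lemma meval_lin v w :
  mpoly.meval v (lin w) = \sum_(j < n) w j * v j.
Proof.
rewrite /lin (raddf_sum (mpoly.meval v)); apply: eq_bigr => j _ /=.
by rewrite mpoly.mevalZ mpoly.mevalXU.
Qed.

Lemma meval_rho v : mpoly.meval v rho = qf v.
Proof.
rewrite /rho (raddf_sum (mpoly.meval v)); apply: eq_bigr => j _ /=.
by rewrite rmorphXn /= mpoly.mevalXU.
Qed.

Lemma meval_dirder d w f : f \is hom n d ->
  mpoly.meval w (dirder w f) = mpoly.meval w f *+ d.
Proof.
move=> hf; rewrite -(raddfMn (mpoly.meval w)) -(euler hf) /dirder.
rewrite !(raddf_sum (mpoly.meval w)); apply: eq_bigr => j _ /=.
by rewrite mpoly.mevalZ mpoly.mevalM mpoly.mevalXU.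
Qed.

End Laplacian.

(** * Rotation-invariant means of polynomials over the sphere *)

(** The three properties of the normalised surface integral from which all
    moments of the sphere follow; the last one is the infinitesimal form of
    rotation invariance. *)
Definition spherical_mean (F : comNzRingType) (n : nat)
    (L : {scalar MP n F}) : Prop :=
  [/\ L 1 = 1,
      forall f : MP n F, L (rho F n * f) = L f &
      forall (i j : 'I_n) (f : MP n F),
        L (vX i * mpoly.mderiv j f - vX j * mpoly.mderiv i f) = 0].

Section SphericalMean.
Variables (F : numFieldType) (n : nat) (L : {scalar MP n F}).
Hypothesis hL : spherical_mean L.
Implicit Types f g q : MP n F.
Implicit Types w : 'I_n -> F.

(** Summing the rotation identity for [vX i * f] over [i] turns the generators
    of rotations into the Euler operator and [rho]. *)
Lemma mean_mderiv d (j : 'I_n) f : f \is hom n d ->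
  L (mpoly.mderiv j f) = (n%:R + d%:R - 1) * L (vX j * f).
Proof.
case: hL => _ Lrho Lrot hf.
have : L (\sum_(i < n) (vX i * mpoly.mderiv j (vX i * f)
                        - vX j * mpoly.mderiv i (vX i * f))) = 0.
  by rewrite linear_sum big1 // => i _ /=; exact: Lrot.
rewrite big_split /= sumrN -mulr_sumr.
under eq_bigr do rewrite mpoly.mderivM mulrDr !mulrA -expr2 mderiv_vX.
under [X in _ - _ * X]eq_bigr do rewrite mpoly.mderivM mderiv_vX eqxx mul1r.
rewrite !big_split /= (bigD1 j)//= eqxx mulr1 big1 ?addr0; last first.
  by move=> i ij; rewrite eq_sym (negbTE ij) mulr0 mul0r.
rewrite -mulr_suml -/(rho F n) (euler hf) big_const_ord iter_addr_0.
rewrite mulrDr !mulrnAr linearB 2!linearD 2!linearMn Lrho /= => H.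
move: (L (vX j * f)) (L (mpoly.mderiv j f)) H => a b H.
apply/eqP; rewrite -subr_eq0; apply/eqP; rewrite -[RHS]H.
by rewrite -[a *+ n]mulr_natl -[a *+ d]mulr_natl; ring.
Qed.

(** [mean_mderiv] for each derivative of [f], then Euler's identity. *)
Lemma mean_lap d f : f \is hom n d ->
  L (lap f) = (n%:R + d%:R - 2) * d%:R * L f.
Proof.
case: d => [|d] hf.
  by rewrite (lap_hom1 hf)// linear0 mulr0 mul0r.
case: hL => _ Lrho _.
have -> : L (lap f) = \sum_(j < n) (n%:R + d%:R - 1) * L (vX j * mpoly.mderiv j f).
  rewrite linear_sum; apply: eq_bigr => j _ /=.
  by rewrite (mean_mderiv j (hom_mderiv j hf)).
rewrite -mulr_sumr -linear_sum (euler hf) linearMn /= -mulr_natl -natr1.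
ring.
Qed.

(** By [mean_lap] the mean of [f * g] is a multiple of the mean of its Laplacian,
    and each term of the Leibniz rule for [lap (f * g)] is again a product as in
    the statement, of smaller total degree. *)
Lemma mean_polyharmonic_ortho p d e f g :
  f \is hom n d -> g \is hom n e -> iter p (@lap F n) f = 0 ->
  (e + 2 * p <= d)%N -> (0 < n)%N -> L (f * g) = 0.
Proof.
move=> + + + + n0; have [N] := ubnP (d + e)%N.
elim: N => // N IH in p d e f g *; rewrite ltnS => deN hf hg pf ep.
have [p0|p0] := posnP p; first by move: pf; rewrite p0 /= => ->; rewrite mul0r linear0.
have d2 : (1 < d)%N by lia.
have c0 : (n%:R + (d + e)%:R - 2) * (d + e)%:R != 0 :> F.
  rewrite -natrD -natrB; last by lia.
  by rewrite -natrM pnatr_eq0 muln_eq0; apply/negP => /orP[] /eqP; lia.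
apply: (mulfI c0); rewrite mulr0 -(mean_lap (mpoly.dhomogM hf hg)) lapM.
have lap_iter k h : iter k (@lap F n) (lap h) = lap (iter k (@lap F n) h).
  by rewrite -iterSr.
have -> : L (lap f * g + (\sum_(j < n) mpoly.mderiv j f * mpoly.mderiv j g) *+ 2
  + f * lap g) = L (lap f * g) +
    (\sum_(j < n) L (mpoly.mderiv j f * mpoly.mderiv j g)) *+ 2 + L (f * lap g).
  by rewrite linearD linearD linearMn linear_sum.
have -> : L (lap f * g) = 0.
  apply: (IH p.-1 d.-2 e _ _ _ (hom_lap hf) hg); [by lia| |by lia].
  by rewrite -iterSr prednK.
rewrite big1 ?add0r ?mul0rn ?add0r => [|j _].
  have [e1|e1] := leqP e 1; first by rewrite (lap_hom1 hg)// mulr0 linear0.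
  by apply: (IH p d e.-2 _ _ _ hf (hom_lap hg) pf); lia.
case: e hg deN ep {c0} => [|e] hg deN ep.
  by rewrite (mderiv_hom0 j hg) mulr0 linear0.
apply: (IH p d.-1 e _ _ _ (hom_mderiv j hf) (hom_mderiv j hg)); [by lia| |by lia].
have comm k h : iter k (@lap F n) (mpoly.mderiv j h) =
    mpoly.mderiv j (iter k (@lap F n) h).
  elim: k => //= k ->; rewrite /lap linear_sum; apply: eq_bigr => i _ /=.
  by rewrite !(mpoly.mderiv_comm i j).
by rewrite comm pf linear0.
Qed.

(** The step of the induction that determines the moments: it lowers the power
    of [lin w], either trading a factor for a derivative of [f] along [w] or
    removing two factors. *)
Lemma mean_linS w d e f : f \is hom n e ->
  (n%:R + e%:R + d%:R - 1) * L (f * lin w ^+ d.+1) =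
  L (dirder w f * lin w ^+ d) + d%:R * qf w * L (f * lin w ^+ d.-1).
Proof.
move=> hf.
have hh : f * lin w ^+ d \is hom n (e + d)%N.
  by apply: mpoly.dhomogM => //; have := mpoly.dhomogMn d (hom_lin w); rewrite mul1n.
have -> : L (f * lin w ^+ d.+1) = \sum_(j < n) w j * L (vX j * (f * lin w ^+ d)).
  rewrite exprS mulrCA [in LHS]/lin mulr_suml linear_sum.
  by apply: eq_bigr => j _ /=; rewrite -scalerAl linearZ.
rewrite mulr_sumr.
under eq_bigr do
  rewrite mulrCA -[n%:R + _ + _]addrA -natrD -(mean_mderiv _ hh) mpoly.mderivM.
have -> : \sum_(j < n) w j * L (mpoly.mderiv j f * lin w ^+ d
     + f * mpoly.mderiv j (lin w ^+ d)) =
  L (dirder w f * lin w ^+ d + f * (dirder w (lin w ^+ d))).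
  rewrite /dirder mulr_suml mulr_sumr -big_split linear_sum.
  apply: eq_bigr => j _ /=.
  by rewrite -scalerAl -scalerAr -scalerDr linearZ.
have -> : dirder w (lin w ^+ d) = (d%:R * qf w) *: lin w ^+ d.-1.
  rewrite /qf mulr_sumr scaler_suml; apply: eq_bigr => j _ /=.
  rewrite mderivXn mderiv_lin -scalerAr mulr1 scalerMnl scalerA.
  by congr (_ *: _); rewrite -mulr_natl; ring.
by rewrite linearD /= -scalerAr linearZ.
Qed.

End SphericalMean.

(** * Gegenbauer coefficients and zonal polynomials *)

Section GegenbauerCoef.
Variables (F : numFieldType) (n : nat).

Definition rise (j : nat) : F := \prod_(i < j) (n%:R + 2 * i%:R).

(** The coefficient of [t ^+ (m - 2 * k)] in the Gegenbauer polynomial of degree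
    [m] and order [n / 2]; the Gamma quotient times the powers of 2 is
    [rise (m - k) / 2 ^+ k]. *)
Definition gcoef (m k : nat) : F :=
  if (2 * k <= m)%N then
    (-1) ^+ k * rise (m - k) / (2 ^+ k * (k`!)%:R * ((m - 2 * k)`!)%:R)
  else 0.

Lemma riseS j : rise j.+1 = rise j * (n%:R + 2 * j%:R).
Proof. by rewrite /rise big_ord_recr. Qed.

Lemma gcoefE a k :
  gcoef (a + 2 * k) k = (-1) ^+ k * rise (a + k) / (2 ^+ k * (k`!)%:R * (a`!)%:R).
Proof.
by rewrite /gcoef leq_addl addnK; congr (_ * rise _ / _); lia.
Qed.

Lemma gcoef_gt m k : (m < 2 * k)%N -> gcoef m k = 0.
Proof. by rewrite /gcoef ltnNge => /negbTE ->. Qed.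

Lemma gcoef00 : gcoef 0 0 = 1.
Proof. by rewrite (gcoefE 0 0) /rise big_ord0 !expr0 !mulr1 divr1. Qed.

Let factS k : (k.+1`!)%:R = (k%:R + 1) * (k`!)%:R :> F.
Proof. by rewrite factS natrM -natr1. Qed.

Let fact0 k : (k`!)%:R != 0 :> F.
Proof. by rewrite pnatr_eq0 -lt0n fact_gt0. Qed.

Let natS0 k : k%:R + 1 != 0 :> F.
Proof. by rewrite natr1 pnatr_eq0. Qed.

Let pow20 k : 2 ^+ k != 0 :> F.
Proof. by rewrite expf_neq0// pnatr_eq0. Qed.

Let natSS0 k : k%:R + 2 != 0 :> F.
Proof. by rewrite -natrD pnatr_eq0 addn2. Qed.

Let nat1S0 k : 1 + k%:R + 1 != 0 :> F.
Proof. by rewrite addrAC addrC natSS0. Qed.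

(** The coefficients of the identity
    [(m + 1) C_(m+1)(t) = (n + m) t C_m(t) - (1 - t^2) C_m'(t)]. *)
Lemma gcoef_recS m k :
  m.+1%:R * gcoef m.+1 k = gcoef m k * (n%:R + 2 * m%:R - 2 * k%:R)
    - (if k is k'.+1 then gcoef m k' * (m - 2 * k')%:R else 0).
Proof.
have [km|mk] := leqP (2 * k) m.
  rewrite -[m](subnK km); move: (m - 2 * k)%N => a.
  rewrite -[(a + 2 * k).+1]addSn !gcoefE -[rise (a.+1 + k)]/(rise (a + k).+1).
  rewrite riseS factS.
  case: k {km} => [|k].
    by field; rewrite ?fact0 ?natS0 ?natSS0 ?nat1S0 ?pow20.
  have -> : (a + 2 * k.+1 - 2 * k = a + 2)%N by lia.
  have -> : (a + 2 * k.+1 = a.+2 + 2 * k)%N by lia.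
  rewrite gcoefE -[(a.+2 + k)%N]/(a + k).+2 addnS !riseS !factS !exprS.
  field.
  by rewrite ?fact0 ?natS0 ?natSS0 ?nat1S0 ?pow20.
rewrite (gcoef_gt mk) mul0r sub0r.
case: k mk => [|k] mk; first by lia.
have [e|ne] := eqVneq (2 * k.+1)%N m.+1.
  have -> : (m - 2 * k = 1)%N by lia.
  have -> : (m = 1 + 2 * k)%N by lia.
  rewrite gcoefE (_ : (1 + 2 * k).+1 = 0 + 2 * k.+1)%N; last by lia.
  rewrite gcoefE add0n add1n !exprS factS.
  by field; rewrite ?fact0 ?natS0 ?natSS0 ?nat1S0 ?pow20.
rewrite gcoef_gt ?mulr0; last by lia.
have [e|ne'] := eqVneq (2 * k)%N m.
  by rewrite e subnn mulr0 oppr0.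
by rewrite gcoef_gt ?mul0r ?oppr0//; lia.
Qed.

(** The coefficients of the three-term recurrence
    [(m + 2) C_(m+2)(t) = (n + 2 m + 2) t C_(m+1)(t) - (n + m) C_m(t)]. *)
Lemma gcoef_rec3 m k :
  m.+2%:R * gcoef m.+2 k = (n%:R + 2 * m.+1%:R) * gcoef m.+1 k
    - (if k is k'.+1 then (n + m)%:R * gcoef m k' else 0).
Proof.
have [km|mk] := leqP (2 * k) m.+1.
  case: k km => [|k] km.
    rewrite -[in gcoef _ _](addn0 m.+2) -[in gcoef m.+1 _](addn0 m.+1).
    rewrite -(muln0 2) !gcoefE !addn0 [rise m.+2]riseS !factS.
    by field; rewrite ?fact0 ?natS0 ?natSS0 ?nat1S0 ?pow20.
  have [a ->] : exists a, m = (a + 1 + 2 * k)%N by exists (m - 1 - 2 * k)%N; lia.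
  have -> : ((a + 1 + 2 * k).+1 = a + 2 * k.+1)%N by lia.
  rewrite -[(a + 2 * k.+1).+1]addSn !gcoefE addn1.
  rewrite -[(a.+1 + k.+1)%N]/(a + k.+1).+1 addnS -[(a.+1 + k)%N]/(a + k).+1.
  rewrite !riseS !factS !exprS.
  by field; rewrite ?fact0 ?natS0 ?natSS0 ?nat1S0 ?pow20.
rewrite (gcoef_gt mk) mulr0 sub0r.
case: k mk => [|k] mk; first by lia.
have [e|ne] := eqVneq (2 * k.+1)%N m.+2.
  have -> : (m = 0 + 2 * k)%N by lia.
  have -> : ((0 + 2 * k).+2 = 0 + 2 * k.+1)%N by lia.
  rewrite !gcoefE !add0n riseS !exprS factS.
  by field; rewrite ?fact0 ?natS0 ?natSS0 ?nat1S0 ?pow20.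
by rewrite !gcoef_gt ?mulr0 ?oppr0//; lia.
Qed.

(** The left-hand side is the coefficient of [lin w ^+ a * rho ^+ k], up to a
    power of [qf w], in the Laplacian of the zonal harmonic of degree [m]. *)
Lemma gcoef_harmonic a k (m := (a + 2 + 2 * k)%N) :
  (gcoef m k - (if k is k'.+1 then gcoef (m - 2) k' else 0))
    * ((a + 2) * (a + 1))%:R
  + (gcoef m k.+1 - gcoef (m - 2) k)
    * ((2 * k.+1)%:R * (n%:R + 2 * (a + k)%:R)) = 0.
Proof.
rewrite /m gcoefE.
have -> : (a + 2 + 2 * k - 2 = a + 2 * k)%N by lia.
have -> : (a + 2 + 2 * k = a + 2 * k.+1)%N by lia.
rewrite !gcoefE addn2 -[(a.+2 + k)%N]/(a + k).+2 [(a + k.+1)%N]addnS !riseS !factS !exprS.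
case: k {m} => [|k].
  by field; rewrite ?fact0 ?natS0 ?natSS0 ?nat1S0 ?pow20.
have -> : (a + 2 * k.+1 = a.+2 + 2 * k)%N by lia.
rewrite !gcoefE -[(a.+2 + k)%N]/(a + k).+2 [(a + k.+1)%N]addnS.
rewrite !riseS !factS !exprS.
by field; rewrite ?fact0 ?natS0 ?natSS0 ?nat1S0 ?pow20.
Qed.

End GegenbauerCoef.

Section ZonalPolynomial.
Variables (F : numFieldType) (n : nat).
Implicit Types (w : 'I_n -> F) (f g q : MP n F).
Local Notation gc := (gcoef F n).

(** The solid Gegenbauer polynomial with pole [w]: [lin w], [rho] and [qf w] are
    [x . w], [x . x] and [w . w]. *)
Definition gpoly w m : MP n F :=
  \sum_(k < m.+1) (gc m k * qf w ^+ k) *: (lin w ^+ (m - 2 * k) * rho F n ^+ k).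

Definition zpoly p w m : MP n F :=
  gpoly w m
  - (if (2 * p <= m)%N then qf w ^+ p *: (rho F n ^+ p * gpoly w (m - 2 * p))
     else 0).

Lemma hom_linXn w a : lin w ^+ a \is hom n a.
Proof. by have := mpoly.dhomogMn a (hom_lin w); rewrite mul1n. Qed.

Lemma hom_rhoXn k : rho F n ^+ k \is hom n (2 * k)%N.
Proof. exact: (mpoly.dhomogMn k (hom_rho F n)). Qed.

Lemma hom_gpoly w m : gpoly w m \is hom n m.
Proof.
apply: rpred_sum => k _; have [km|mk] := leqP (2 * k) m; last first.
  by rewrite gcoef_gt// mul0r scale0r rpred0.
apply: rpredZ.
by have := mpoly.dhomogM (hom_linXn w (m - 2 * k)) (hom_rhoXn k); rewrite subnK.
Qed.

Lemma hom_zpoly p w m : zpoly p w m \is hom n m.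
Proof.
apply: rpredB; first exact: hom_gpoly.
case: ifP => [pm|_]; last exact: rpred0.
apply: rpredZ.
by have := mpoly.dhomogM (hom_rhoXn p) (hom_gpoly w (m - 2 * p)); rewrite subnKC.
Qed.

Section Mean.
Variable L : {scalar MP n F}.
Hypothesis hL : spherical_mean L.

Lemma mean_rhoXn k f : L (rho F n ^+ k * f) = L f.
Proof.
case: hL => _ Lrho _.
by elim: k => [|k IH]; rewrite ?expr0 ?mul1r// exprS -mulrA Lrho.
Qed.

Lemma mean_gpolyE w m f : L (f * gpoly w m) =
  \sum_(k < m.+1) gc m k * qf w ^+ k * L (f * lin w ^+ (m - 2 * k)).
Proof.
rewrite mulr_sumr linear_sum; apply: eq_bigr => k _ /=.
by rewrite -scalerAr linearZ /= mulrA [f * _ * _]mulrC mean_rhoXn.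
Qed.

(** The induction hypothesis is applied to the derivative of [f] along [w], whose
    value at [w] is a multiple of that of [f] by Euler's identity; [mean_linS]
    rewrites its means as means of [f], and the coefficients combine by
    [gcoef_recS]. *)
Lemma mean_gpoly w m f : f \is hom n m -> L (f * gpoly w m) = mpoly.meval w f.
Proof.
elim: m f => [|m IH] f hf.
  have -> : f = (mpoly.mcoeff (mpoly.mnm0 : mpoly.multinom n) f)%:A.
    apply/mpoly.mpolyP => u; rewrite mpoly.alg_mpolyC mpoly.mcoeffC.
    have [->|u0] := eqVneq (mpoly.mnm0 : mpoly.multinom n) u; first by rewrite mulr1.
    rewrite mulr0 (mpoly.dhomog_nemf_coeff hf)//= mpoly.mdeg_eq0.
    by rewrite eq_sym.
  rewrite mean_gpolyE big_ord1 /= gcoef00 !expr0 !mul1r mulr1 linearZ /=.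
  by case: hL => -> _ _; rewrite mpoly.mevalZ mpoly.meval1.
have m0 : m.+1%:R != 0 :> F by rewrite pnatr_eq0.
apply: (mulfI m0); rewrite [RHS]mulr_natl -(meval_dirder w hf).
rewrite -(IH _ (hom_dirder w hf)) !mean_gpolyE.
pose M k := qf w ^+ k * L (f * lin w ^+ (m.+1 - 2 * k)).
transitivity (\sum_(k < m.+1) (gc m k * (n%:R + 2 * m%:R - 2 * k%:R) * M k
                               - gc m k * (m - 2 * k)%:R * M k.+1)); last first.
  apply: eq_bigr => k _; have [km|mk] := leqP (2 * k) m; last first.
    by rewrite gcoef_gt// !mul0r subrr.
  have := mean_linS hL w (m - 2 * k) hf.
  rewrite /M (_ : (m.+1 - 2 * k = (m - 2 * k).+1)%N); last by lia.
  rewrite (_ : (m.+1 - 2 * k.+1 = (m - 2 * k).-1)%N); last by lia.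
  rewrite (_ : n%:R + _ + _ - 1 = n%:R + 2 * m%:R - 2 * k%:R :> F); last first.
    by rewrite natrB// natrM -natr1; ring.
  move: (L _) (L _) (L _) => c b a e.
  have -> : b = (n%:R + 2 * m%:R - 2 * k%:R) * a - (m - 2 * k)%:R * qf w * c.
    by rewrite e addrK.
  by rewrite exprS; ring.
rewrite big_split sumrN /= mulr_sumr.
rewrite (eq_bigr (fun k : 'I_m.+2 => m.+1%:R * gc m.+1 k * M k)); last first.
  by move=> k _; rewrite /M !mulrA.
under eq_bigr do rewrite gcoef_recS mulrBl.
rewrite big_split sumrN /=; congr (_ - _).
  by rewrite big_ord_recr /= gcoef_gt ?mul0r ?addr0//; lia.
by rewrite big_ord_recl /= mul0r add0r.
Qed.

(** The second term of [zpoly] pairs with [f] to zero by orthogonality. *)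
Lemma mean_zpoly p w m f : (0 < n)%N -> f \is hom n m ->
  iter p (@lap F n) f = 0 -> L (f * zpoly p w m) = mpoly.meval w f.
Proof.
move=> n0 hf pf; rewrite mulrBr linearB /= mean_gpoly//.
case: ifP => [pm|_]; last by rewrite mulr0 linear0 subr0.
rewrite -scalerAr linearZ /= mulrCA mean_rhoXn.
rewrite (mean_polyharmonic_ortho hL hf (hom_gpoly _ _) pf)// ?mulr0 ?subr0//.
by rewrite subnK.
Qed.

End Mean.

Lemma lap_linM_rhoXn w a k : lap (lin w ^+ a * rho F n ^+ k) =
  ((a * a.-1)%:R * qf w) *: (lin w ^+ a.-2 * rho F n ^+ k)
  + ((2 * k)%:R * (n%:R + 2 * a%:R + 2 * k.-1%:R))
      *: (lin w ^+ a * rho F n ^+ k.-1).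
Proof.
have dlin b j : mpoly.mderiv j (lin w ^+ b) = (b%:R * w j) *: lin w ^+ b.-1.
  by rewrite mderivXn mderiv_lin -scalerAr mulr1 scalerMnl mulr_natl.
have laplin : lap (lin w ^+ a) = ((a * a.-1)%:R * qf w) *: lin w ^+ a.-2.
  rewrite /lap /qf mulr_sumr scaler_suml; apply: eq_bigr => j _.
  by rewrite dlin linearZ /= dlin scalerA natrM; congr (_ *: _); ring.
have laprho : lap (rho F n ^+ k) =
    ((2 * k)%:R * (n%:R + 2 * k.-1%:R)) *: rho F n ^+ k.-1.
  elim: k => [|k IH].
    by rewrite mul0r scale0r (lap_hom1 (d := 0))// mpoly.dhomog1.
  rewrite exprS (lap_rhoM (hom_rhoXn k)) IH -scalerAr.
  case: k {IH} => [|k]; last first.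
    rewrite -exprS -scaler_nat -scalerDl; congr (_ *: _) => /=.
    by ring.
  rewrite !muln0 mul0r scale0r addr0 /= expr0 -scaler_nat.
  by congr (_ *: _); ring.
have cross : \sum_(j < n) mpoly.mderiv j (lin w ^+ a)
      * mpoly.mderiv j (rho F n ^+ k) =
    (2 * (a * k))%:R *: (lin w ^+ a * rho F n ^+ k.-1).
  rewrite (eq_bigr (fun j => (2 * (a * k))%:R *:
      (w j *: vX j * (lin w ^+ a.-1 * rho F n ^+ k.-1)))) => [|j _]; last first.
    rewrite dlin mderivXn mderiv_rho !mulrnAr -mulrnA -!scalerAl scalerA.
    rewrite -[in LHS]scaler_nat scalerA [rho F n ^+ _ * _]mulrC mulrCA.
    by congr (_ *: _); ring.
  rewrite -scaler_sumr -mulr_suml -/(lin w).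
  case: a {laplin} => [|a]; first by rewrite mul0n muln0 !scale0r.
  by rewrite mulrA -exprS.
rewrite lapM laplin laprho cross -scalerAl -scalerAr -addrA; congr (_ + _).
rewrite scalerMnl -scalerDl; congr (_ *: _).
by rewrite -mulr_natl; ring.
Qed.

(** For [p = 1] the two Gegenbauer terms combine into a harmonic polynomial:
    consecutive terms of the Laplacian cancel by [gcoef_harmonic]. *)
Lemma lap_zpoly1 w m : lap (zpoly 1 w m) = 0.
Proof.
have [m1|m2] := leqP m 1; first exact: (lap_hom1 (hom_zpoly 1 w m)).
rewrite /zpoly m2 muln1.
pose h k := gc m k - (if k is k'.+1 then gc (m - 2) k' else 0).
have -> : gpoly w m - qf w ^+ 1 *: (rho F n ^+ 1 * gpoly w (m - 2)) =
    \sum_(k < m.+1) (h k * qf w ^+ k) *: (lin w ^+ (m - 2 * k) * rho F n ^+ k).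
  under [RHS]eq_bigr do rewrite mulrBl scalerBl.
  rewrite big_split sumrN /=; congr (_ - _).
  rewrite big_ord_recl mul0r scale0r add0r mulr_sumr scaler_sumr.
  have -> : m = (m - 2).+2 by lia.
  rewrite [RHS]big_ord_recr /= gcoef_gt ?mul0r ?scale0r ?addr0; last by lia.
  rewrite !subSS subn0; apply: eq_bigr => k _.
  rewrite -scalerAr scalerA !expr1 exprS [rho F n * _]mulrC -mulrA -exprSr.
  rewrite (_ : (m - 2).+2 - 2 * (lift ord0 k) = m - 2 - 2 * k)%N; last first.
    by rewrite /= /bump /=; lia.
  by congr (_ *: _); rewrite mulrA [qf w * _]mulrC -mulrA.
rewrite linear_sum.
under eq_bigr do rewrite linearZ /= lap_linM_rhoXn scalerDr.
rewrite big_split /= big_ord_recr [X in _ + X]big_ord_recl /=.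
rewrite mul0r scale0r scaler0 add0r.
rewrite [h m]/h (_ : m - 2 * m = 0)%N; last by lia.
rewrite mul0n mul0r scale0r scaler0 addr0 -big_split big1 //= => k _.
rewrite /bump leq0n add1n add0n.
have [km|mk] := leqP (2 * k.+1) m; last first.
  have -> : h k.+1 = 0.
    by rewrite /h !gcoef_gt ?subrr//; lia.
  rewrite mul0r scale0r addr0.
  have [->|->] : (m - 2 * k = 0)%N \/ (m - 2 * k = 1)%N by lia.
    by rewrite mul0n mul0r scale0r scaler0.
  by rewrite muln0 mul0r scale0r scaler0.
have [a em] : exists a, m = (a + 2 + 2 * k)%N by exists (m - 2 - 2 * k)%N; lia.
have e : h k * ((a + 2) * (a + 1))%:R
    + h k.+1 * ((2 * k.+1)%:R * (n%:R + 2 * (a + k)%:R)) = 0.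
  by have := gcoef_harmonic F n a k; rewrite -em.
have -> : (m - 2 * k = a.+2)%N by lia.
have -> : (m - 2 * k.+1 = a)%N by lia.
rewrite /= !scalerA -scalerDl -[RHS](scale0r (lin w ^+ a * rho F n ^+ k)).
congr (_ *: _); rewrite -[RHS](mulr0 (qf w ^+ k.+1)) -e exprS addn2 addn1 natrD.
by ring.
Qed.

Lemma lap_rhoXnM_harmonic d k f : f \is hom n d -> lap f = 0 ->
  exists c : nat, lap (rho F n ^+ k.+1 * f) = (rho F n ^+ k * f) *+ c.
Proof.
move=> hf lf; elim: k => [|k [c IH]].
  exists (2 * n + 4 * d)%N.
  by rewrite expr1 expr0 mul1r (lap_rhoM hf) lf mulr0 addr0.
exists (2 * n + 4 * (2 * k.+1 + d) + c)%N.
rewrite exprS -mulrA (lap_rhoM (mpoly.dhomogM (hom_rhoXn _) hf)) IH.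
by rewrite mulrnAr mulrA -exprS -mulrnDr.
Qed.

Lemma polyharmonic_rhoXnM d k p f : f \is hom n d -> lap f = 0 -> (k < p)%N ->
  iter p (@lap F n) (rho F n ^+ k * f) = 0.
Proof.
move=> hf lf; elim: p k => // p IH k kp; rewrite iterSr.
have iter0 j : iter j (@lap F n) 0 = 0 by elim: j => //= j ->; rewrite linear0.
case: k kp => [|k] kp; first by rewrite expr0 mul1r lf iter0.
have [c ->] := lap_rhoXnM_harmonic k hf lf.
have -> : forall j g, iter j (@lap F n) (g *+ c) = iter j (@lap F n) g *+ c.
  by move=> j g; elim: j => //= j ->; rewrite linearMn.
by rewrite IH ?mul0rn.
Qed.

(** Telescoping: [zpoly p w m] is the sum over [k < p] of the products of
    [(qf w *: rho) ^+ k] with the harmonic polynomials [zpoly 1 w (m - 2 * k)]. *)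
Lemma polyharmonic_zpoly p w m : iter p (@lap F n) (zpoly p w m) = 0.
Proof.
have iterD j (f g : MP n F) : iter j (@lap F n) (f + g) =
    iter j (@lap F n) f + iter j (@lap F n) g.
  by elim: j => //= j ->; rewrite linearD.
have iter0 j : iter j (@lap F n) 0 = 0 by elim: j => //= j ->; rewrite linear0.
have iterZ j c f : iter j (@lap F n) (c *: f) = c *: iter j (@lap F n) f.
  by elim: j => //= j ->; rewrite linearZ.
suff: forall r, (r <= p)%N -> iter p (@lap F n) (zpoly r w m) = 0 by apply.
elim=> [|r IH] rp.
  by rewrite /zpoly leq0n !expr0 mul1r scale1r subn0 subrr.
have -> : zpoly r.+1 w m = zpoly r w m +
    if (2 * r <= m)%N then qf w ^+ r *: (rho F n ^+ r * zpoly 1 w (m - 2 * r))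
    else 0.
  rewrite /zpoly; case: (leqP (2 * r) m) => rm; last first.
    by rewrite subr0 addr0 ifF ?subr0//; apply/negbTE; rewrite -ltnNge; lia.
  rewrite mulrBr scalerBr addrA subrK; congr (_ - _).
  rewrite (_ : (2 * 1 <= m - 2 * r) = (2 * r.+1 <= m))%N; last by lia.
  case: ifP => _; last by rewrite mulr0 scaler0.
  rewrite -scalerAr scalerA -exprD mulrA -exprD addn1 -subnDA.
  by congr (_ *: (_ * gpoly _ (m - _))); lia.
rewrite iterD (IH (ltnW rp)) add0r; case: ifP => _; last exact: iter0.
rewrite iterZ (polyharmonic_rhoXnM (hom_zpoly _ _ _) (lap_zpoly1 _ _))//.
by rewrite scaler0.
Qed.

End ZonalPolynomial.

(** * Shears preserve Lebesgue measure on tuples *)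

Section Shear.
Variable R : realType.
Local Notation leb := (@lebesgue_measure R).

Definition preserves d (T : measurableType d) (mu : set T -> \bar R)
    (f : T -> T) : Prop :=
  forall A, measurable A -> mu (f @^-1` A) = mu A.

Definition translate (n : nat) (a : 'I_n -> R) (t : n.-tuple R) : n.-tuple R :=
  [tuple tnth t j + a j | j < n].

Definition shear (n : nat) (i j : 'I_n) (a : R) (t : n.-tuple R) : n.-tuple R :=
  [tuple tnth t k + (if k == i then a * tnth t j else 0) | k < n].

Lemma measurable_shear n (i j : 'I_n) a : measurable_fun setT (shear i j a).
Proof.
apply/measurable_fun_tnthP => k.
rewrite (_ : _ \o _ =
    fun t => tnth t k + (if k == i then a * tnth t j else 0)); last first.
  by apply/funext => t /=; rewrite tnth_mktuple.
apply: measurable_funD; first exact: measurable_tnth.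
case: (k == i) => //; apply: measurable_funM => //; exact: measurable_tnth.
Qed.

Lemma lebesgue_preserves_shift (a : R) :
  @preserves _ (measurableTypeR R) leb (fun x => x + a).
Proof.
have ma : @measurable_fun _ _ (measurableTypeR R) (measurableTypeR R) setT
    (fun x => x + a).
  exact: measurable_funD.
move=> A mA; apply/esym.
pose nu : {measure set (measurableTypeR R) -> \bar R} :=
  measure_function_pushforward__canonical__measure_function_Measure leb ma.
apply: (@lebesgue_measure_unique _ nu) => // X [[c b] _ <-].
rewrite /nu /= /pushforward /=.
rewrite (_ : _ @^-1` _ = `]c - a, b - a]%classic); last first.
  by apply/seteqP; split => x /=; rewrite !in_itv /= ltrBlDr lerBrDr.
rewrite !lebesgue_measure_itv /= !lte_fin ltrD2r -!EFinB.
by rewrite (_ : b - a - (c - a) = b - c)//; ring.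
Qed.

Definition tcons n (x : R) (t : n.-tuple R) : n.+1.-tuple R := [tuple of x :: t].

Lemma tnth_tcons0 n (x : R) (t : n.-tuple R) : tnth (tcons x t) ord0 = x.
Proof. exact: tnth0. Qed.

Lemma tnth_tconsS n (x : R) (t : n.-tuple R) k :
  tnth (tcons x t) (lift ord0 k) = tnth t k.
Proof. exact: tnthS. Qed.

Lemma measurable_consl n (x : R) :
  measurable_fun setT (fun t : n.-tuple R => tcons x t).
Proof. exact: measurable_cons. Qed.

Lemma measurable_consr n (t : n.-tuple R) :
  measurable_fun setT (fun x : R => tcons x t).
Proof. exact: measurable_cons. Qed.

Lemma lebesgue_tuple_iteratedl n (A : set (n.+1.-tuple R)) :
  lebesgue_tuple R n.+1 A =
  (\int[leb]_x lebesgue_tuple R n [set t | A (tcons x t)])%E.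
Proof.
apply: eq_integral => x _ /=; congr (lebesgue_tuple R n _).
by apply/seteqP; split => t; rewrite /xsection /= inE.
Qed.

Lemma lebesgue_tuple_iteratedr n (A : set (n.+1.-tuple R)) : measurable A ->
  lebesgue_tuple R n.+1 A =
  (\int[lebesgue_tuple R n]_t leb [set x | A (tcons x t)])%E.
Proof.
move=> mA.
pose B := (fun u : measurableTypeR R * n.-tuple R => tcons u.1 u.2)
  @^-1` A.
have mB : measurable B.
  by rewrite -[B]setTI; apply: measurable_cons.
transitivity ((leb \x^ lebesgue_tuple R n)%E B).
  apply: (@product_measure_unique _ _ _ _ R leb (lebesgue_tuple R n)) => //.
  by move=> X Y mX mY; rewrite /= product_measure2E.
apply: eq_integral => t _ /=; congr (leb _).
by apply/seteqP; split => x; rewrite /ysection /= inE.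
Qed.

(** Fubini's theorem, slicing by the value of the first coordinate. *)
Lemma lebesgue_tuple_preservesl n (f : n.+1.-tuple R -> n.+1.-tuple R)
    (g : R -> n.-tuple R -> n.-tuple R) :
  (forall x, preserves (lebesgue_tuple R n) (g x)) ->
  (forall x t, f (tcons x t) = tcons x (g x t)) ->
  preserves (lebesgue_tuple R n.+1) f.
Proof.
move=> pg fE A mA; rewrite !lebesgue_tuple_iteratedl; apply: eq_integral => x _.
rewrite -[RHS](pg x); last first.
  by rewrite -[X in measurable X]setTI; apply: measurable_consl.
by congr (lebesgue_tuple R n _); apply/seteqP; split => t /=; rewrite fE.
Qed.

(** Fubini's theorem in the other order: along each line parallel to the first
    axis, [f] is a translation. *)
Lemma lebesgue_tuple_preservesr n (f : n.+1.-tuple R -> n.+1.-tuple R)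
    (h : n.-tuple R -> R) : measurable_fun setT f ->
  (forall x t, f (tcons x t) = tcons (x + h t) t) ->
  preserves (lebesgue_tuple R n.+1) f.
Proof.
move=> mf fE A mA; rewrite !lebesgue_tuple_iteratedr//; last first.
  by rewrite -[X in measurable X]setTI; apply: mf.
apply: eq_integral => t _; rewrite -[RHS](@lebesgue_preserves_shift (h t)).
  by congr (leb _); apply/seteqP; split => x /=; rewrite fE.
by rewrite -[X in measurable X]setTI; apply: measurable_consr.
Qed.

Lemma tuple_consP n (t : n.+1.-tuple R) : exists x s, t = tcons x s.
Proof. by case/tupleP: t => x s; exists x, s; apply/val_inj. Qed.

Lemma eq_cons_tuple n (t : n.+1.-tuple R) x (s : n.-tuple R) :
  tnth t ord0 = x -> (forall k, tnth t (lift ord0 k) = tnth s k) ->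
  t = tcons x s.
Proof.
move=> t0 ts; apply: eq_from_tnth => k.
by case: (unliftP ord0 k) => [k' ->|->]; rewrite ?tnth_tconsS ?tnth_tcons0.
Qed.

Lemma lebesgue_tuple_preserves_translate n (a : 'I_n -> R) :
  preserves (lebesgue_tuple R n) (translate a).
Proof.
elim: n a => [|n IH] a.
  by move=> A _; congr (lebesgue_tuple R 0 _); apply/seteqP; split => t /=;
    rewrite (_ : translate a t = t)//; apply: eq_from_tnth => -[].
pose a0 (t : n.+1.-tuple R) := tcons (thead t + a ord0) [tuple of behead t].
pose a1 (t : n.+1.-tuple R) :=
  tcons (thead t) (translate (fun k => a (lift ord0 k)) [tuple of behead t]).
have aE : translate a = a0 \o a1.
  apply/funext => t; have [x [s ->]] := tuple_consP t.
  apply: eq_cons_tuple => [|k]; first by rewrite tnth_mktuple tnth_tcons0.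
  rewrite tnth_mktuple tnth_tconsS /= (_ : [tuple of behead _] =
     translate (fun k => a (lift ord0 k)) [tuple of behead (tcons x s)]).
    by rewrite tnth_mktuple; congr (tnth _ _ + _); apply/val_inj.
  exact/val_inj.
have cE x (s : n.-tuple R) : [tuple of behead (tcons x s)] = s.
  exact/val_inj.
move=> A mA; rewrite aE comp_preimage.
have ma0 : measurable_fun setT a0.
  apply: measurable_cons; last exact: measurable_behead.
  by apply: measurable_funD => //; exact: measurable_tnth.
rewrite (@lebesgue_tuple_preservesl _ a1
    (fun=> translate (fun k => a (lift ord0 k)))).
- by apply: (lebesgue_tuple_preservesr (h := fun=> a ord0)) => // x t;
    apply/val_inj.
- by move=> x; exact: IH.
- by move=> x t; rewrite /a1 cE; apply/val_inj.
- by rewrite -[X in measurable X]setTI; apply: ma0.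
Qed.

(** By induction on the dimension with Fubini's theorem: a shear acts on the
    slices with one coordinate fixed as a shear or a translation. *)
Lemma lebesgue_tuple_preserves_shear n (i j : 'I_n) (a : R) : i != j ->
  preserves (lebesgue_tuple R n) (shear i j a).
Proof.
elim: n i j => [[]//|n IH] i j.
case: (unliftP ord0 i) => [i' ->|->]; case: (unliftP ord0 j) => [j' ->|->].
- rewrite (inj_eq (lift_inj (h := ord0))) => ij.
  apply: (lebesgue_tuple_preservesl (g := fun=> shear i' j' a)).
    by move=> x; exact: IH.
  move=> x t; apply: eq_cons_tuple => [|k].
    by rewrite tnth_mktuple tnth_tcons0 addr0.
  by rewrite !tnth_mktuple !tnth_tconsS (inj_eq (lift_inj (h := ord0))).
- move=> _; apply: (lebesgue_tuple_preservesl
    (g := fun x => translate (fun k => if k == i' then a * x else 0))).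
    by move=> x; exact: lebesgue_tuple_preserves_translate.
  move=> x t; apply: eq_cons_tuple => [|k].
    by rewrite tnth_mktuple tnth_tcons0 addr0.
  by rewrite !tnth_mktuple !tnth_tconsS tnth_tcons0 (inj_eq (lift_inj (h := ord0))).
- move=> _; apply: (lebesgue_tuple_preservesr (h := fun t => a * tnth t j')).
    exact: measurable_shear.
  move=> x t; apply: eq_cons_tuple => [|k].
    by rewrite tnth_mktuple eqxx tnth_tcons0 tnth_tconsS.
  by rewrite tnth_mktuple tnth_tconsS addr0.
- by rewrite eqxx.
Qed.

End Shear.

(** * Rotation invariance of the surface measure *)

Section Rotation.
Variable R : realType.

Definition prot (n : nat) (i j : 'I_n) (c s : R) (t : n.-tuple R) : n.-tuple R :=
  [tuple if k == i then c * tnth t i - s * tnth t j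
         else if k == j then s * tnth t i + c * tnth t j else tnth t k | k < n].

(** A rotation by an angle [th] is the product of three shears, with
    coefficients [- tan (th / 2)], [sin th] and [- tan (th / 2)]. *)
Lemma prot_shear n (i j : 'I_n) (c s : R) : i != j -> c ^+ 2 + s ^+ 2 = 1 ->
  1 + c != 0 ->
  prot i j c s = shear i j (- s / (1 + c)) \o shear j i s
                   \o shear i j (- s / (1 + c)).
Proof.
move=> ij cs c0; apply/funext => t; apply: eq_from_tnth => k.
have ji : (j == i) = false by rewrite eq_sym (negbTE ij).
rewrite /= !tnth_mktuple eqxx ji eqxx.
have as_ : - s / (1 + c) * s = c - 1.
  have ss : s ^+ 2 = (1 - c) * (1 + c).
    have -> : (1 - c) * (1 + c) = 1 - c ^+ 2 by ring.
    by rewrite -cs addrAC subrr add0r.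
  by rewrite mulrAC mulNr -expr2 ss mulNr mulfK// opprB.
set a := - s / (1 + c) in as_ *.
have ac : a * (1 + c) = - s by rewrite /a divfK.
have [->|ki] := eqVneq k i.
  move: (tnth t i) (tnth t j) => x y.
  rewrite (negbTE ij) !addr0 -mulNr -ac.
  have -> : x + a * y + a * (y + s * (x + a * y)) =
    x + 2 * a * y + a * s * x + a * s * a * y by ring.
  by rewrite as_; ring.
have [->|kj] := eqVneq k j; last by rewrite !addr0.
rewrite !addr0; move: (tnth t i) (tnth t j) => x y.
have -> : y + s * (x + a * y) = y + s * x + a * s * y by ring.
by rewrite as_; ring.
Qed.

Lemma measurable_prot n (i j : 'I_n) (c s : R) :
  measurable_fun setT (prot i j c s).
Proof.
apply/measurable_fun_tnthP => k.
rewrite (_ : _ \o _ = fun t => if k == i then c * tnth t i - s * tnth t j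
    else if k == j then s * tnth t i + c * tnth t j else tnth t k); last first.
  by apply/funext => t /=; rewrite tnth_mktuple.
have mZ (a : R) l : measurable_fun setT (fun t : n.-tuple R => a * tnth t l).
  by apply: measurable_funM => //; exact: measurable_tnth.
case: (k == i); first exact: measurable_funB.
case: (k == j); first exact: measurable_funD.
exact: measurable_tnth.
Qed.

Lemma preserves_comp d (T : measurableType d) (mu : set T -> \bar R)
    (f g : T -> T) : measurable_fun setT f ->
  preserves mu f -> preserves mu g -> preserves mu (f \o g).
Proof.
move=> mf pf pg A mA; have mfA : measurable (f @^-1` A).
  by rewrite -[X in measurable X]setTI; exact: mf.
by rewrite -(pf A mA) -(pg _ mfA).
Qed.

Lemma lebesgue_tuple_preserves_prot n (i j : 'I_n) (c s : R) : i != j ->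
  c ^+ 2 + s ^+ 2 = 1 -> 1 + c != 0 ->
  preserves (lebesgue_tuple R n) (prot i j c s).
Proof.
move=> ij cs c0; rewrite (prot_shear ij cs c0).
have ji : j != i by rewrite eq_sym.
have pij := @lebesgue_tuple_preserves_shear R n i j (- s / (1 + c)) ij.
have pji := @lebesgue_tuple_preserves_shear R n j i s ji.
have mij := @measurable_shear R n i j (- s / (1 + c)).
have mji := @measurable_shear R n j i s.
exact: preserves_comp (measurableT_comp mij mji) (preserves_comp mij pij pji) pij.
Qed.

Lemma sqnorm_prot n (i j : 'I_n) (c s : R) (t : n.-tuple R) : i != j ->
  c ^+ 2 + s ^+ 2 = 1 -> sqnorm (prot i j c s t) = sqnorm t.
Proof.
move=> ij cs; have ji : j != i by rewrite eq_sym.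
rewrite /sqnorm (bigD1 i)//= (bigD1 j)//= [RHS](bigD1 i)//= (bigD1 j ji)//=.
rewrite !tnth_mktuple eqxx (negbTE ji) eqxx !addrA; congr (_ + _).
  transitivity ((c ^+ 2 + s ^+ 2) * (tnth t i ^+ 2 + tnth t j ^+ 2)); first by ring.
  by rewrite cs mul1r.
apply: eq_bigr => k /andP[ki kj].
by rewrite tnth_mktuple (negbTE ki) (negbTE kj).
Qed.

Lemma normalize_prot n (i j : 'I_n) (c s : R) (t : n.-tuple R) : i != j ->
  c ^+ 2 + s ^+ 2 = 1 ->
  normalize (prot i j c s t) = prot i j c s (normalize t).
Proof.
move=> ij cs; apply: eq_from_tnth => k.
rewrite !tnth_mktuple sqnorm_prot//.
by case: ifP => _; [|case: ifP => _]; rewrite ?mulrBl ?mulrDl ?mulrA.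
Qed.

Lemma cone_measure_preserves_prot n (i j : 'I_n) (c s : R) : i != j ->
  c ^+ 2 + s ^+ 2 = 1 -> 1 + c != 0 ->
  preserves (cone_measure R n) (prot i j c s).
Proof.
move=> ij cs c0 A mA; rewrite /= /cone_measure /pushforward /= /mrestr.
rewrite -[RHS](lebesgue_tuple_preserves_prot ij cs c0); last first.
  apply: measurableI; last exact: measurable_real_ball.
  by rewrite -[X in measurable X]setTI; apply: measurable_normalize.
congr (lebesgue_tuple R n _); apply/seteqP; split => t /=;
  by rewrite normalize_prot// /real_ball /= sqnorm_prot.
Qed.

Lemma sphere_measure_preserves_prot n (i j : 'I_n) (c s : R) (A : set _) :
  (cone_measure R n setT != 0)%E -> (cone_measure R n setT != +oo)%E ->
  i != j -> c ^+ 2 + s ^+ 2 = 1 -> 1 + c != 0 -> measurable A ->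
  sphere_measure R n (prot i j c s @^-1` A) = sphere_measure R n A.
Proof.
move=> m0 moo ij cs c0 mA; rewrite /= /mnormalize (negbTE m0) (negbTE moo) /=.
by congr (_ * _)%E; apply: cone_measure_preserves_prot.
Qed.

End Rotation.

Section TotalMass.
Variable R : realType.

(** Cubes are the sets of known volume that bound the ball from inside and from
    outside and, with [r = 0], the origin. *)
Definition cube (n : nat) (r : R) : set (n.-tuple R) :=
  [set t | forall j, `|tnth t j| <= r].

Lemma measurable_cube n r : measurable (@cube n r).
Proof.
rewrite (_ : @cube n r =
    \bigcap_(j in [set: 'I_n]) (fun t => tnth t j) @^-1` `[- r, r]); last first.
  apply/seteqP; split => [t /= tr j _ /=|t /= tr j]; first by rewrite in_itv /= -ler_norml.
  by have := tr j I; rewrite /= in_itv /= -ler_norml.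
apply: fin_bigcap_measurable => // j _.
by rewrite -[X in measurable X]setTI; apply: measurable_tnth.
Qed.

Lemma lebesgue_tuple_cube n r : 0 <= r ->
  lebesgue_tuple R n (@cube n r) = ((2 * r) ^+ n)%:E.
Proof.
move=> r0.
have lE : @lebesgue_measure R `[- r, r]%classic = (2 * r)%:E.
  rewrite lebesgue_measure_itv /= lte_fin -EFinB.
  case: ltP => [_|rr]; first by congr EFin; ring.
  by rewrite (_ : r = 0) ?mulr0//; lra.
elim: n => [|n IH].
  by rewrite /= diracE mem_set ?expr0// => -[].
transitivity ((@lebesgue_measure R \x lebesgue_tuple R n)%E
                (`[- r, r]%classic `*` @cube n r)).
  congr (product_measure1 _ _ _); apply/seteqP; split => -[x t] /=.
    move=> h; split; first by have := h ord0; rewrite tnth0 in_itv /= ler_norml.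
    by move=> j; have := h (lift ord0 j); rewrite tnthS.
  rewrite in_itv /= -ler_norml => -[h1 h2] k.
  by case: (unliftP ord0 k) => [k' ->|->]; rewrite ?tnthS ?tnth0.
rewrite product_measure1E//; last exact: measurable_cube.
by rewrite [X in (X * _)%E]lE IH -EFinM exprS.
Qed.

Lemma cube_sub_ball n : @cube n n.+1%:R^-1 `<=` real_ball R n.
Proof.
move=> t ht; rewrite /real_ball /= /sqnorm.
have n1 : 0 < n.+1%:R :> R by rewrite ltr0n.
apply: (@le_lt_trans _ _ (\sum_(j < n) n.+1%:R^-1 ^+ 2)).
  apply: ler_sum => j _; rewrite -real_normK ?num_real//.
  by rewrite ler_pXn2r ?nnegrE// ?invr_ge0 ?ltW//; exact: ht.
rewrite big_const_ord iter_addr_0 -[_ *+ n]mulr_natl exprVn.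
rewrite ltr_pdivrMr ?exprn_gt0// mul1r.
by rewrite -natrX ltr_nat expnS expn1; lia.
Qed.

Lemma ball_sub_cube n : real_ball R n `<=` @cube n 1.
Proof.
move=> t; rewrite /real_ball /= /sqnorm => ht j.
rewrite -(@expr_le1 _ 2)// real_normK ?num_real//; apply: le_trans (ltW ht).
by rewrite (bigD1 j)//= lerDl sumr_ge0// => k _; exact: sqr_ge0.
Qed.

Lemma cone_measureT n : cone_measure R n setT = lebesgue_tuple R n (real_ball R n).
Proof. by rewrite /= /cone_measure /pushforward /= /mrestr preimage_setT setTI. Qed.

Lemma cone_measureT_neq0 n : (cone_measure R n setT != 0)%E.
Proof.
rewrite cone_measureT gt_eqF//.
apply: (@lt_le_trans _ _ (lebesgue_tuple R n (@cube n n.+1%:R^-1))).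
  rewrite lebesgue_tuple_cube ?invr_ge0// lte_fin exprn_gt0// mulr_gt0//.
apply: le_measure; rewrite ?inE; [exact: measurable_cube| |exact: cube_sub_ball].
exact: measurable_real_ball.
Qed.

Lemma cone_measureT_neqy n : (cone_measure R n setT != +oo)%E.
Proof.
rewrite cone_measureT lt_eqF//.
apply: (@le_lt_trans _ _ (lebesgue_tuple R n (@cube n 1))).
  apply: le_measure; rewrite ?inE; [|exact: measurable_cube|exact: ball_sub_cube].
  exact: measurable_real_ball.
by rewrite lebesgue_tuple_cube// ltry.
Qed.

Lemma measurable_real_sphere n : measurable (real_sphere R n).
Proof.
rewrite (_ : real_sphere R n = @sqnorm R n @^-1` [set 1]); last first.
  by apply/seteqP; split.
by rewrite -[X in measurable X]setTI; exact: measurable_sqnorm.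
Qed.

(** [normalize] maps all vectors except the origin into the sphere, and the
    origin is a null set. *)
Lemma sphere_measure_sphere n : (0 < n)%N ->
  sphere_measure R n (real_sphere R n) = 1%E.
Proof.
move=> n0; have mS := @measurable_real_sphere n.
suff e : sphere_measure R n (~` real_sphere R n) = 0%E.
  rewrite -[RHS](probability_setT (sphere_measure R n)).
  rewrite -[in RHS](setvU (real_sphere R n)) measureU ?setICl//.
    by rewrite [X in (_ = X + _)%E]e add0e.
  exact: measurableC.
rewrite /= /mnormalize (negbTE (@cone_measureT_neq0 n)).
rewrite (negbTE (@cone_measureT_neqy n)) /=.
rewrite [X in (X * _)%E](_ : _ = 0%E) ?mul0e//.
rewrite /cone_measure /pushforward /= /mrestr.
apply: (subset_measure0 (B := @cube n 0)).
- apply: measurableI; last exact: measurable_real_ball.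
  by rewrite -[X in measurable X]setTI; apply: measurable_normalize => //;
    exact: measurableC.
- exact: measurable_cube.
- move=> t [/= tS _] j; apply: contrapT => tj; apply: tS.
  have tn : 0 < sqnorm t.
    rewrite /sqnorm (bigD1 j)//= ltr_pwDl//.
      by rewrite exprn_even_gt0//= -normr_le0; apply/negP.
    by rewrite sumr_ge0// => k _; exact: sqr_ge0.
  rewrite /real_sphere /= -(@divff _ (sqnorm t)) ?gt_eqF//.
  rewrite [in LHS]/sqnorm [X in _ = X / _]/sqnorm mulr_suml.
  apply: eq_bigr => k _.
  by rewrite tnth_mktuple expr_div_n sqr_sqrtr ?ltW.
- by have := @lebesgue_tuple_cube n 0 (lexx 0); rewrite mulr0 expr0n gtn_eqF.
Qed.

End TotalMass.

(** * The mean of a polynomial over the sphere *)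

Section SphereIntegral.
Variables (R : realType) (n : nat).
Local Notation sigma := (sphere_measure R n).
Local Notation S := (real_sphere R n).

(** Measurable functions that are bounded on the sphere, hence integrable there. *)
Definition tame (g : n.-tuple R -> R) : Prop :=
  measurable_fun setT g /\ exists M : R, forall t, S t -> `|g t| <= M.

Definition ctame (g : n.-tuple R -> R[i]) : Prop :=
  tame (fun t => complex.Re (g t)) /\ tame (fun t => complex.Im (g t)).

Lemma tame_cst a : tame (fun=> a).
Proof. by split => //; exists `|a|. Qed.

Lemma tameD g h : tame g -> tame h -> tame (fun t => g t + h t).
Proof.
move=> [mg [M gM]] [mh [N hN]]; split; first exact: measurable_funD.
by exists (M + N) => t St; rewrite (le_trans (ler_normD _ _))// lerD ?gM ?hN.
Qed.

Lemma tameM g h : tame g -> tame h -> tame (fun t => g t * h t).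
Proof.
move=> [mg [M gM]] [mh [N hN]]; split; first exact: measurable_funM.
by exists (M * N) => t St; rewrite normrM ler_pM ?gM ?hN.
Qed.

Lemma tameN g : tame g -> tame (fun t => - g t).
Proof.
move=> tg; rewrite (_ : (fun t => _) = fun t => -1 * g t).
  exact: tameM (tame_cst _) tg.
by apply/funext => t; rewrite mulN1r.
Qed.

Lemma tame_tnth j : tame (fun t => tnth t j).
Proof.
split; first exact: measurable_tnth.
exists 1 => t; rewrite /real_sphere /= /sqnorm => St.
rewrite -(@expr_le1 _ 2)// real_normK ?num_real// -St.
by rewrite (bigD1 j)//= lerDl sumr_ge0// => k _; exact: sqr_ge0.
Qed.

Lemma tame_integrable g : tame g -> sigma.-integrable S (EFin \o g).
Proof.
move=> [mg [M gM]]; apply: measurable_bounded_integrable.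
- exact: measurable_real_sphere.
- by rewrite (le_lt_trans (probability_le1 _ _)) ?ltry//;
    exact: measurable_real_sphere.
- exact: measurable_funTS.
- exists M; split; first exact: num_real.
  by move=> N MN t /gM /le_trans; apply; exact: ltW.
Qed.

Lemma ctame_cst a : ctame (fun=> a).
Proof. by split; exact: tame_cst. Qed.

Lemma ctameD g h : ctame g -> ctame h -> ctame (fun t => g t + h t).
Proof.
move=> [g1 g2] [h1 h2]; split.
  rewrite (_ : (fun t => _) = fun t => complex.Re (g t) + complex.Re (h t)).
    exact: tameD.
  by apply/funext => t; case: (g t) (h t) => [? ?] [? ?].
rewrite (_ : (fun t => _) = fun t => complex.Im (g t) + complex.Im (h t)).
  exact: tameD.
by apply/funext => t; case: (g t) (h t) => [? ?] [? ?].
Qed.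

Lemma ctameM g h : ctame g -> ctame h -> ctame (fun t => g t * h t).
Proof.
move=> [g1 g2] [h1 h2]; split.
  rewrite (_ : (fun t => _) = fun t => complex.Re (g t) * complex.Re (h t)
      + - (complex.Im (g t) * complex.Im (h t))).
    by apply: tameD; [|apply: tameN]; exact: tameM.
  by apply/funext => t; case: (g t) (h t) => [? ?] [? ?].
rewrite (_ : (fun t => _) = fun t => complex.Re (g t) * complex.Im (h t)
    + complex.Im (g t) * complex.Re (h t)).
  by apply: tameD; exact: tameM.
by apply/funext => t; case: (g t) (h t) => [? ?] [? ?].
Qed.

Lemma ctame_meval (f : MP n R[i]) :
  ctame (fun t => mpoly.meval ((embed t) 0) f).
Proof.
elim/mpoly.mpolyind: f => [|c m f _ _ IH].
  rewrite (_ : (fun t => _) = fun=> 0); first exact: ctame_cst.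
  by apply/funext => t; rewrite mpoly.meval0.
rewrite (_ : (fun t => _) = fun t => c * \prod_(j < n) (tnth t j)%:C ^+ m j
    + mpoly.meval ((embed t) 0) f); last first.
  apply/funext => t; rewrite mpoly.mevalD mpoly.mevalZ mpoly.mevalX.
  by congr (_ * _ + _); apply: eq_bigr => j _; rewrite mxE.
apply: ctameD => //; apply: ctameM; first exact: ctame_cst.
have pw (g : n.-tuple R -> R[i]) k : ctame g -> ctame (fun t => g t ^+ k).
  move=> tg; elim: k => [|k IHk]; first exact: ctame_cst.
  rewrite (_ : (fun t => _) = fun t => g t * g t ^+ k); first exact: ctameM.
  by apply/funext => t; rewrite exprS.
elim: (index_enum _) => [|j s IHs].
  rewrite (_ : (fun t => _) = fun=> 1); first exact: ctame_cst.
  by apply/funext => t; rewrite big_nil.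
rewrite (_ : (fun t => _) = fun t : n.-tuple R => (tnth t j)%:C ^+ m j
    * \prod_(j <- s) (tnth t j)%:C ^+ m j).
  apply: ctameM => //; apply: pw; split; first exact: tame_tnth.
  exact: tame_cst.
by apply/funext => t; rewrite big_cons.
Qed.

Lemma sphere_integralP (a : R[i]) g h : ctame g -> ctame h ->
  sphere_integral (fun t => a * g t + h t) =
  a * sphere_integral g + sphere_integral h.
Proof.
move=> [g1 g2] [h1 h2].
have mS := @measurable_real_sphere R n.
have I (c d : R) u v w : tame u -> tame v -> tame w ->
    \int[sigma]_(t in S) (c * u t + d * v t + w t) =
    c * (\int[sigma]_(t in S) u t) + d * (\int[sigma]_(t in S) v t)
    + \int[sigma]_(t in S) w t.
  move=> tu tv tw; have tcu := tameM (tame_cst c) tu.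
  have tdv := tameM (tame_cst d) tv.
  rewrite RintegralD//; [|exact: tame_integrable (tameD tcu tdv)
    |exact: tame_integrable].
  rewrite RintegralD//; [|exact: tame_integrable..].
  by rewrite !RintegralZl//; exact: tame_integrable.
rewrite /sphere_integral; case: a => a b.
rewrite [X in X +i* _](@eq_Rintegral _ _ _ sigma S (fun t => a * complex.Re (g t)
    + - b * complex.Im (g t) + complex.Re (h t))); last first.
  by move=> t _; case: (g t) (h t) => [? ?] [? ?] /=; rewrite mulNr.
rewrite [X in _ +i* X](@eq_Rintegral _ _ _ sigma S (fun t => a * complex.Im (g t)
    + b * complex.Re (g t) + complex.Im (h t))); last first.
  by move=> t _; case: (g t) (h t) => [? ?] [? ?].
by rewrite !I//; simpc; rewrite ?mulNr.
Qed.

Lemma sphere_integral_conj g : ctame g ->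
  sphere_integral (fun t => (g t)^*%C) = ((sphere_integral g)^*)%C.
Proof.
move=> [g1 g2]; rewrite /sphere_integral /=; congr (_ +i* _).
  by apply: eq_Rintegral => t _; case: (g t).
rewrite (@eq_Rintegral _ _ _ sigma S (fun t => -1 * complex.Im (g t))).
  by rewrite RintegralZl ?mulN1r//; [exact: measurable_real_sphere
    |exact: tame_integrable].
by move=> t _; case: (g t) => ? ? /=; rewrite mulN1r.
Qed.

Lemma sphere_integral_cst (a : R[i]) : (0 < n)%N ->
  sphere_integral (fun _ : n.-tuple R => a) = a.
Proof.
move=> n0; have mS := @measurable_real_sphere R n.
have e : fine (sigma S) = 1 by rewrite (sphere_measure_sphere R n0).
have I (r : R) : \int[sigma]_(t in S) r = r.
  by rewrite (Rintegral_cst _ mS) [X in _ * X]e mulr1.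
by rewrite /sphere_integral !I; case: a.
Qed.

Lemma eq_sphere_integral g h : (forall t, S t -> g t = h t) ->
  sphere_integral g = sphere_integral h.
Proof.
move=> gh; rewrite /sphere_integral; congr (_ +i* _);
  by apply: eq_Rintegral => t; rewrite inE => /gh ->.
Qed.

(** The change of variables formula; sphere and surface measure are both
    invariant. *)
Lemma sphere_integral_prot g (i j : 'I_n) (c s : R) : ctame g -> i != j ->
  c ^+ 2 + s ^+ 2 = 1 -> 1 + c != 0 ->
  sphere_integral (fun t => g (prot i j c s t)) = sphere_integral g.
Proof.
move=> [g1 g2] ij cs c0; rewrite /sphere_integral.
have mS := @measurable_real_sphere R n.
have I u : tame u -> \int[sigma]_(t in S) u (prot i j c s t) =
    \int[sigma]_(t in S) u t.
  move=> tu; rewrite /Rintegral; congr fine.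
  have mp := @measurable_prot R n i j c s.
  have SE : prot i j c s @^-1` S = S.
    by apply/seteqP; split => t /=; rewrite /real_sphere /= sqnorm_prot.
  have tup : tame (fun t => u (prot i j c s t)).
    case: tu => mu [M uM]; split; first exact: measurableT_comp.
    by exists M => t St; apply: uM; rewrite /real_sphere /= sqnorm_prot.
  pose nu : {measure set (n.-tuple R) -> \bar R} :=
    measure_function_pushforward__canonical__measure_function_Measure sigma mp.
  transitivity (\int[nu]_(t in S) (u t)%:E)%E.
    rewrite (@integral_pushforward _ _ _ _ _ _ mp) ?SE//.
      by apply/measurable_EFinP; case: tu.
    exact: tame_integrable tup.
  apply: eq_measure_integral => A mA _.
  by apply: sphere_measure_preserves_prot => //;
    [exact: cone_measureT_neq0|exact: cone_measureT_neqy].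
by congr (_ +i* _); apply: I.
Qed.

End SphereIntegral.

(** * First-order expansion along a curve of linear maps *)

Section Taylor.
Variables (F : comNzRingType) (n : nat).
Variables U V : 'I_n -> MP n F.
Implicit Types f : MP n F.

(** [H] is the expansion of [f] in powers of [t] along [t |-> x + t U + t^2 V]. *)
Definition expansion f (H : {poly MP n F}) : Prop :=
  [/\ forall x t, mpoly.meval
        (fun k => x k + t * mpoly.meval x (U k) + t ^+ 2 * mpoly.meval x (V k)) f
        = (map_poly (mpoly.meval x) H).[t],
      H`_0 = f & H`_1 = \sum_(k < n) U k * mpoly.mderiv k f].

Lemma expansionD f g H K : expansion f H -> expansion g K ->
  expansion (f + g) (H + K).
Proof.
move=> [H1 H2 H3] [K1 K2 K3]; split=> [x t||]; last 2 first.
- by rewrite coefD H2 K2.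
- rewrite coefD H3 K3 -big_split; apply: eq_bigr => k _ /=.
  by rewrite linearD mulrDr.
by rewrite mpoly.mevalD H1 K1 rmorphD hornerD.
Qed.

Lemma expansionM f g H K : expansion f H -> expansion g K ->
  expansion (f * g) (H * K).
Proof.
move=> [H1 H2 H3] [K1 K2 K3]; split=> [x t||]; last 2 first.
- by rewrite coefM big_ord1 H2 K2.
- rewrite coefM big_ord_recl big_ord1 /= /bump /= H2 K2 H3 K3 addrC.
  rewrite mulr_suml mulr_sumr -big_split; apply: eq_bigr => k _ /=.
  by rewrite mpoly.mderivM mulrDr -mulrA; congr (_ + _); rewrite mulrCA.
by rewrite mpoly.mevalM H1 K1 rmorphM hornerM.
Qed.

Lemma expansionC c : expansion (c%:A) (c%:A)%:P.
Proof.
split=> [x t||]; last 2 first.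
- by rewrite coefC.
- by rewrite coefC big1// => k _; rewrite mpoly.alg_mpolyC mpoly.mderivC mulr0.
by rewrite map_polyC hornerC /= mpoly.mevalZ mpoly.meval1 !mpoly.mevalZ mpoly.meval1.
Qed.

Lemma expansion_vX k : expansion (vX k) ((vX k)%:P + (U k)%:P * 'X + (V k)%:P * 'X^2).
Proof.
split=> [x t||]; last 2 first.
- by rewrite !coefD coefC !coefCM coefX coefXn !mulr0 !addr0.
- rewrite !coefD coefC !coefCM coefX coefXn mulr0 mulr1 addr0 add0r.
  rewrite (bigD1 k)//= mderiv_vX eqxx mulr1 big1 ?addr0// => i ik.
  by rewrite mderiv_vX (negbTE ik) mulr0.
rewrite !rmorphD !rmorphM /= !map_polyC /= !map_polyX.
rewrite !hornerD !hornerM !hornerC !hornerX -expr2 !mpoly.mevalXU.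
by rewrite [t * _]mulrC [t ^+ 2 * _]mulrC.
Qed.

Lemma expansion_exists f : exists H, expansion f H.
Proof.
elim/mpoly.mpolyind: f => [|c m f _ _ [K HK]].
  by exists (0%:A)%:P; rewrite -(scale0r 1); exact: expansionC.
suff [H HH] : exists H, expansion (mpoly.mpolyX F m) H.
  exists ((c%:A)%:P * H + K); apply: expansionD => //.
  have -> : c *: mpoly.mpolyX F m = c%:A * mpoly.mpolyX F m by rewrite -scalerAl mul1r.
  by apply: expansionM => //; exact: expansionC.
rewrite mpoly.mpolyXE_id.
have pw g k : (exists H, expansion g H) -> exists H, expansion (g ^+ k) H.
  move=> [H HH]; elim: k => [|k [K' HK']].
    by exists (1%:A)%:P; rewrite expr0 -[X in expansion X]scale1r; exact: expansionC.
  by exists (H * K'); rewrite exprS; exact: expansionM.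
elim: (index_enum _) => [|j s [K' HK']].
  rewrite big_nil; exists (1%:A)%:P; rewrite -[X in expansion X]scale1r.
  exact: expansionC.
rewrite big_cons; have [|H HH] := pw (vX j) (m j).
  by eexists; exact: expansion_vX.
by exists (H * K'); exact: expansionM.
Qed.

End Taylor.

(** * The surface integral as a spherical mean *)

Lemma meval_homZ (F : comNzRingType) (n d : nat) (f : MP n F) (a : F)
    (v : 'I_n -> F) : f \is hom n d ->
  mpoly.meval (fun k => a * v k) f = a ^+ d * mpoly.meval v f.
Proof.
move=> hf; rewrite !mpoly.mevalE mulr_sumr !big_seq; apply: eq_bigr => m mf.
rewrite mulrCA; congr (_ * _).
have <- : mpoly.mdeg m = d by exact: (mpoly.dhomog_mf hf).
rewrite mpoly.mdegE expr_sum -big_split /=; apply: eq_bigr => j _.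
by rewrite exprMn.
Qed.

(** In characteristic zero the naturals are infinitely many points. *)
Lemma poly_nat_roots (F : numFieldType) (q : {poly F}) :
  (forall k : nat, q.[k%:R] = 0) -> q = 0.
Proof.
move=> hq; apply: contrapT => /eqP q0.
suff : (size [seq k%:R : F | k <- iota 0 (size q)] < size q)%N.
  by rewrite size_map size_iota ltnn.
apply: max_poly_roots => //; first by apply/allP => _ /mapP[k _ ->]; rewrite rootE hq.
by rewrite map_inj_uniq ?iota_uniq// => a b /eqP; rewrite eqr_nat => /eqP.
Qed.

Section SphereMean.
Variables (R : realType) (n : nat).
Hypothesis n0 : (0 < n)%N.
Implicit Types f : MP n R[i].

Definition smean f : R[i] :=
  sphere_integral (fun t => mpoly.meval ((embed t) 0) f).

Fact smean_is_linear : linear_for *%R smean.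
Proof.
move=> a f g; rewrite -sphere_integralP; [|exact: ctame_meval..].
by apply: eq_sphere_integral => t _; rewrite mpoly.mevalD mpoly.mevalZ.
Qed.
HB.instance Definition _ :=
  GRing.isLinear.Build R[i] (MP n R[i]) R[i] *%R smean smean_is_linear.

Lemma smean1 : smean 1 = 1.
Proof.
rewrite -[RHS](sphere_integral_cst (n := n) 1 n0).
by apply: eq_sphere_integral => t _; rewrite mpoly.meval1.
Qed.

Lemma smean_rho f : smean (rho R[i] n * f) = smean f.
Proof.
apply: eq_sphere_integral => t; rewrite /real_sphere /= => St.
rewrite mpoly.mevalM meval_rho (_ : qf _ = 1) ?mul1r//.
rewrite /qf -[RHS](rmorph1 (real_complex R)) -St rmorph_sum.
by apply: eq_bigr => j _; rewrite mxE rmorphXn.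
Qed.

(** Rotations in the [i, j]-plane have the rational parametrisation
    [c = (1 - t^2) / (1 + t^2)], [s = 2 t / (1 + t^2)]. For homogeneous [f] the
    denominators clear, and invariance becomes an identity between the mean of a
    polynomial in [t] and [(1 + t^2) ^ d] times the mean of [f], valid at all
    natural [t], hence coefficientwise. The coefficient of [t] is the claim. *)
Lemma smean_rotation_hom d f (i j : 'I_n) : i != j -> f \is hom n d ->
  smean (vX i * mpoly.mderiv j f - vX j * mpoly.mderiv i f) = 0.
Proof.
move=> ij hf; have ji : (j == i) = false by rewrite eq_sym (negbTE ij).
(* [x + t U + t^2 V] is [1 + t^2] times the rotation. *)
pose U k : MP n R[i] :=
  if k == i then (-2) *: vX j else if k == j then 2 *: vX i else 0.
pose V k : MP n R[i] := if (k == i) || (k == j) then - vX k else vX k.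
have sumU : \sum_(k < n) U k * mpoly.mderiv k f =
    2 *: (vX i * mpoly.mderiv j f - vX j * mpoly.mderiv i f).
  rewrite (bigD1 i isT) (bigD1 j) /=; last by rewrite ji.
  rewrite big1 => [|k /andP[ki kj]]; last first.
    by rewrite /U (negbTE ki) (negbTE kj) mul0r.
  by rewrite addr0 /U eqxx ji eqxx -!scalerAl scaleNr addrC -scalerBr.
have [H [H1 H2 H3]] := expansion_exists U V f.
pose q := \poly_(k < size H) smean H`_k - smean f *: (1 + 'X^2) ^+ d.
have q0 : q = 0.
  apply: poly_nat_roots => k.
  pose t : R := k%:R; have tC : t%:C = k%:R by rewrite /t rmorph_nat.
  have t1 : 1 + t ^+ 2 != 0 by rewrite gt_eqF// ltr_pwDl// sqr_ge0.
  pose c := (1 - t ^+ 2) / (1 + t ^+ 2); pose s := 2 * t / (1 + t ^+ 2).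
  have cs : c ^+ 2 + s ^+ 2 = 1 by rewrite /c /s; field.
  have c1 : 1 + c != 0.
    have -> : 1 + c = 2 / (1 + t ^+ 2) by rewrite /c; field.
    by rewrite mulf_neq0// invr_eq0.
  have cE : (1 + t ^+ 2) * c = 1 - t ^+ 2 by rewrite mulrC divfK.
  have sE : (1 + t ^+ 2) * s = 2 * t by rewrite mulrC divfK.
  have tE : (1 + t ^+ 2)%:C = 1 + k%:R ^+ 2 by rewrite rmorphD rmorphXn /= tC.
  have -> : q.[k%:R] = smean (\sum_(l < size H) k%:R ^+ l *: H`_l)
      - (1 + t ^+ 2)%:C ^+ d * smean f.
    rewrite hornerD hornerN hornerZ horner_exp hornerD hornerC hornerXn.
    rewrite horner_poly.
    rewrite tE.
    rewrite [RHS]addrC [in RHS]mulrC addrC; congr (_ + _).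
    rewrite [RHS]linear_sum; apply: eq_bigr => l _.
    by rewrite [RHS]linearZ /= mulrC.
  have -> : smean (\sum_(l < size H) k%:R ^+ l *: H`_l) =
      sphere_integral (fun x => (1 + t ^+ 2)%:C ^+ d *
        mpoly.meval ((embed (prot i j c s x)) 0) f + 0).
    apply: eq_sphere_integral => x _; rewrite addr0 -(meval_homZ _ _ hf).
    transitivity (map_poly (mpoly.meval ((embed x) 0)) H).[k%:R].
      rewrite (@horner_coef_wide _ (size H)) ?size_poly// raddf_sum.
      by apply: eq_bigr => l _ /=; rewrite coef_map /= mpoly.mevalZ mulrC.
    rewrite -H1; apply: mpoly.meval_eq => l; rewrite !mxE tnth_mktuple -tC.
    rewrite /U /V; have [->|li] := eqVneq l i.
      rewrite /= raddfN /= mpoly.mevalZ !mpoly.mevalXU !mxE.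
      have -> : (1 + t ^+ 2)%:C * (c * tnth x i - s * tnth x j)%:C =
          ((1 - t ^+ 2) * tnth x i - 2 * t * tnth x j)%:C.
        by rewrite -cE -sE -rmorphM; congr _%:C; ring.
      by rewrite !rmorphB !rmorphM /= ?rmorph1 ?rmorph_nat; ring.
    have [->|lj] := eqVneq l j.
      rewrite /= raddfN /= mpoly.mevalZ !mpoly.mevalXU !mxE.
      have -> : (1 + t ^+ 2)%:C * (s * tnth x i + c * tnth x j)%:C =
          (2 * t * tnth x i + (1 - t ^+ 2) * tnth x j)%:C.
        by rewrite -cE -sE -rmorphM; congr _%:C; ring.
      rewrite rmorphD !rmorphM !rmorphB !rmorphM /= ?rmorph1 ?rmorph_nat.
      by ring.
    rewrite /= raddf0 mulr0 addr0 mpoly.mevalXU !mxE -rmorphM -rmorphXn -rmorphM.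
    by rewrite -rmorphD; congr _%:C; ring.
  rewrite sphere_integralP; last 2 first.
  - have [m1 m2] := ctame_meval f; have mp := @measurable_prot R n i j c s.
    have T u : tame u -> tame (fun x : n.-tuple R => u (prot i j c s x)).
      move=> [mu [M uM]]; split; first exact: measurableT_comp.
      by exists M => x Sx; apply: uM; rewrite /real_sphere /= sqnorm_prot.
    by split; [exact: T m1|exact: T m2].
  - exact: ctame_cst.
  have /= -> := sphere_integral_prot (ctame_meval f) ij cs c1.
  by rewrite sphere_integral_cst// addr0 subrr.
have := congr1 (fun r : {poly R[i]} => r`_1) q0.
rewrite /q coefB coefZ coef0 coef_poly.
have -> : ((1 + 'X^2) ^+ d : {poly R[i]})`_1 = 0.
  elim: d {hf q q0} => [|d IH]; first by rewrite expr0 coefC.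
  by rewrite exprS mulrDl mul1r coefD IH coefXnM add0r.
have -> : (if (1 < size H)%N then smean H`_1 else 0) = smean H`_1.
  by case: ltnP => // ?; rewrite nth_default// linear0.
rewrite mulr0 subr0 H3 sumU [LHS]linearZ => /eqP.
by rewrite mulf_eq0 pnatr_eq0 => /eqP.
Qed.

Lemma smean_spherical : spherical_mean smean.
Proof.
split; [exact: smean1|exact: smean_rho|move=> i j f].
have [->|ij] := eqVneq i j; first by rewrite subrr linear0.
elim/mpoly.mpolyind: f => [|c m f _ _ IH].
  by rewrite !linear0 !mulr0 subrr linear0.
rewrite !linearP !mulrDr opprD addrACA linearD /= IH addr0.
rewrite -!scalerAr -scalerBr linearZ /= (smean_rotation_hom (d := mpoly.mdeg m))//.
  by rewrite mulr0.
by rewrite mpoly.dhomogX.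
Qed.

End SphereMean.

(** * The zonal polyharmonics are the zonal polynomials *)

Section ZonalValues.
Variables (F : numFieldType) (n : nat).

Lemma gcoef_rmorph (G : numFieldType) (h : {rmorphism F -> G}) m k :
  h (gcoef F n m k) = gcoef G n m k.
Proof.
rewrite /gcoef; case: ifP => _; last exact: rmorph0.
rewrite fmorph_div !rmorphM /= !rmorphXn /= rmorphN1 !rmorph_nat /rise.
rewrite rmorph_prod; congr (_ * _ / _); apply: eq_bigr => i _.
by rewrite rmorphD rmorphM /= !rmorph_nat.
Qed.

(** The solid Gegenbauer polynomial in the variables [s = x . w] and
    [P = (x . x) (w . w)]. *)
Definition gsum m (s P : F) : F :=
  \sum_(k < m.+1) gcoef F n m k * s ^+ (m - 2 * k) * P ^+ k.

Definition zsum p m (s P : F) : F :=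
  gsum m s P - (if (2 * p <= m)%N then P ^+ p * gsum (m - 2 * p) s P else 0).

Lemma meval_gpoly m (w x : 'I_n -> F) :
  mpoly.meval x (gpoly w m) = gsum m (\sum_(j < n) w j * x j) (qf w * qf x).
Proof.
rewrite /gpoly (raddf_sum (mpoly.meval x)); apply: eq_bigr => k _ /=.
rewrite mpoly.mevalZ mpoly.mevalM !rmorphXn /= meval_lin meval_rho exprMn.
by rewrite !mulrA; congr (_ * _); rewrite mulrAC.
Qed.

Lemma meval_zpoly p m (w x : 'I_n -> F) :
  mpoly.meval x (zpoly p w m) = zsum p m (\sum_(j < n) w j * x j) (qf w * qf x).
Proof.
rewrite /zpoly mpoly.mevalB meval_gpoly; congr (_ - _).
case: ifP => _; last exact: mpoly.meval0.
rewrite mpoly.mevalZ mpoly.mevalM rmorphXn /= meval_rho meval_gpoly.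
by rewrite exprMn mulrA.
Qed.

End ZonalValues.

Lemma zsum_rmorph (F G : numFieldType) (h : {rmorphism F -> G}) n p m s P :
  h (zsum n p m s P) = zsum n p m (h s) (h P).
Proof.
have hg l : h (gsum n l s P) = gsum n l (h s) (h P).
  rewrite rmorph_sum; apply: eq_bigr => k _ /=.
  by rewrite !rmorphM !rmorphXn /= gcoef_rmorph.
rewrite /zsum rmorphB hg; congr (_ - _).
by case: ifP => _; rewrite ?rmorph0// rmorphM rmorphXn hg.
Qed.

Lemma meval_zpoly_rmorph (F G : numFieldType) (h : {rmorphism F -> G}) n p m
    (w x : 'I_n -> F) :
  h (mpoly.meval x (zpoly p w m)) = mpoly.meval (h \o x) (zpoly p (h \o w) m).
Proof.
have hqf (v : 'I_n -> F) : h (qf v) = qf (h \o v).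
  by rewrite /qf rmorph_sum; apply: eq_bigr => j _; rewrite rmorphXn.
rewrite !meval_zpoly zsum_rmorph rmorphM !hqf rmorph_sum.
by congr (zsum _ _ _ _ _); apply: eq_bigr => j _; rewrite rmorphM.
Qed.

Section Zonal.
Variables (R : realType) (p n : nat).
Hypotheses (p0 : (0 < p)%N) (n0 : (0 < n)%N).
Implicit Types (w : 'I_n -> R[i]) (u v : MP n R[i]).

Definition cj w : 'I_n -> R[i] := @conjc R \o w.

Lemma cjK w : cj (cj w) = w.
Proof. by apply/funext => j; rewrite /cj /= conjcK. Qed.

Lemma polyharmonicE m u : polyharmonic R p m n u <->
  u \is hom n m /\ iter p (@lap R[i] n) u = 0.
Proof. by []. Qed.

Lemma polyharmonic_zpolyE m w : polyharmonic R p m n (zpoly p w m).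
Proof.
by apply/polyharmonicE; split; [exact: hom_zpoly|exact: polyharmonic_zpoly].
Qed.

Lemma rot_conj k : Defs.rot R p k * conjc (Defs.rot R p k) = 1.
Proof.
rewrite /Defs.rot /=; set a := _ * _ / _; simpc.
by rewrite -!expr2 cos2Dsin2 addrC mulrC subrr.
Qed.

Lemma conj_conjc (z : R[i]) : Num.conj z = conjc z.
Proof. by []. Qed.

Lemma restrict_ShatE u x : Shat R p n x ->
  restrict_Shat p u x = mpoly.meval (x 0) u.
Proof. by move=> Sx; rewrite /restrict_Shat /patch mem_set. Qed.

(** On the sphere rotated by a phase, a homogeneous polynomial of degree [m]
    takes its values on the real sphere times the [m]-th power of the phase,
    which the conjugate of the other factor cancels. *)
Lemma Shat_innerE m u v : u \is hom n m -> v \is hom n m ->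
  Shat_inner p (restrict_Shat p u) (restrict_Shat p v) =
  sphere_integral (fun xi : n.-tuple R =>
    mpoly.meval ((embed xi) 0) u * conjc (mpoly.meval ((embed xi) 0) v)).
Proof.
move=> hu hv.
have mv xi j f : real_sphere R n xi -> (j < p)%N -> f \is hom n m ->
    restrict_Shat p f (Defs.rot R p j *: embed xi) =
    Defs.rot R p j ^+ m * mpoly.meval ((embed xi) 0) f.
  move=> Sxi jp hf; rewrite restrict_ShatE; last first.
    by exists j => //; exists xi.
  by rewrite -(meval_homZ _ _ hf); apply: mpoly.meval_eq => k; rewrite mxE.
rewrite /Shat_inner (@eq_sphere_integral _ _ _ (fun xi => p%:R *
    (mpoly.meval ((embed xi) 0) u * conjc (mpoly.meval ((embed xi) 0) v)) + 0)).
  rewrite sphere_integralP; last 2 first.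
  - apply: ctameM; first exact: ctame_meval.
    have [v1 v2] := ctame_meval v; split.
      by rewrite (_ : (fun t => _) = fun t => complex.Re (mpoly.meval ((embed t) 0) v))//;
        apply/funext => t; case: (mpoly.meval _ _).
    rewrite (_ : (fun t => _) = fun t => - complex.Im (mpoly.meval ((embed t) 0) v)).
      exact: tameN.
    by apply/funext => t; case: (mpoly.meval _ _).
  - exact: ctame_cst.
  by rewrite sphere_integral_cst// addr0 mulKf// pnatr_eq0 -lt0n.
move=> xi Sxi; rewrite addr0.
rewrite (eq_bigr (fun=> mpoly.meval ((embed xi) 0) u *
    conjc (mpoly.meval ((embed xi) 0) v))) => [|j _].
  by rewrite big_const_ord iter_addr_0 mulr_natl.
rewrite !mv// conj_conjc [conjc (_ * _)]rmorphM rmorphXn mulrACA -exprMn.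
by rewrite [X in X ^+ _]rot_conj expr1n mul1r.
Qed.

Lemma conj_zpoly m w (xi : n.-tuple R) :
  conjc (mpoly.meval ((embed xi) 0) (zpoly p w m)) =
  mpoly.meval ((embed xi) 0) (zpoly p (cj w) m).
Proof.
rewrite [LHS](meval_zpoly_rmorph (@conjc R)).
by apply: mpoly.meval_eq => j; rewrite /= !mxE conjc_real.
Qed.

(** The conjugate on the real sphere of the zonal polynomial with pole the
    conjugate of [zeta] is the one with pole [zeta]. *)
Lemma zpoly_reproduces m zeta q : Shat R p n zeta ->
  sphere_polyharmonic R p m n q ->
  q zeta = Shat_inner p q (restrict_Shat p (zpoly p (cj (zeta 0)) m)).
Proof.
move=> hz [u [hu pu] ->]; rewrite (Shat_innerE hu (hom_zpoly _ _ _)).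
transitivity (smean (u * zpoly p (zeta 0) m)).
  rewrite (mean_zpoly (@smean_spherical R n n0))//.
  by rewrite restrict_ShatE.
apply: eq_sphere_integral => xi _; rewrite mpoly.mevalM; congr (_ * _).
by rewrite [RHS]conj_zpoly cjK.
Qed.

(** Conjugate symmetry of reproducing kernels: for every complex point [eta] the
    value [v eta] is the mean of [v] times a zonal polynomial, hence conjugate to
    the value at [zeta] of the restriction of another zonal polynomial, which [v]
    reproduces. *)
Lemma reproducing_unique m zeta v : Shat R p n zeta -> polyharmonic R p m n v ->
  (forall q, sphere_polyharmonic R p m n q ->
     q zeta = Shat_inner p q (restrict_Shat p v)) ->
  forall eta, mpoly.meval eta v = mpoly.meval eta (zpoly p (cj (zeta 0)) m).
Proof.
move=> hz [hv pv] vq eta.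
have := vq (restrict_Shat p (zpoly p (cj eta) m)).
have Q : sphere_polyharmonic R p m n (restrict_Shat p (zpoly p (cj eta) m)).
  by exists (zpoly p (cj eta) m) => //; exact: polyharmonic_zpolyE.
move=> /(_ Q) e.
apply: (can_inj (@conjcK R)).
transitivity (mpoly.meval (zeta 0) (zpoly p (cj eta) m)).
  transitivity (restrict_Shat p (zpoly p (cj eta) m) zeta); last first.
    by rewrite restrict_ShatE.
  rewrite e (Shat_innerE (hom_zpoly _ _ _) hv).
  rewrite -(mean_zpoly (@smean_spherical R n n0) (p := p) eta n0 hv pv).
  rewrite -sphere_integral_conj; last exact: ctame_meval.
  apply: eq_sphere_integral => xi _.
  by rewrite mpoly.mevalM rmorphM mulrC /= conj_zpoly.
rewrite [RHS](meval_zpoly_rmorph (@conjc R)).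
rewrite [@conjc R \o cj _]cjK.
rewrite !meval_zpoly mulrC; congr (zsum _ _ _ _ _).
by apply: eq_bigr => j _; rewrite mulrC.
Qed.

Lemma zonalE m x zeta : Shat R p n zeta -> zonal p m x zeta =
  zsum n p m (cdot x (cconj zeta)) (cdot x x * cdot (cconj zeta) (cconj zeta)).
Proof.
move=> hz; set K := zpoly p (cj (zeta 0)) m.
have hZ : [set Z | sphere_polyharmonic R p m n Z /\
    forall q, sphere_polyharmonic R p m n q -> q zeta = Shat_inner p q Z]
    (zonal_sphere p m zeta).
  apply: xgetPex; exists (restrict_Shat p K); split.
    by exists K => //; exact: polyharmonic_zpolyE.
  by move=> q; exact: zpoly_reproduces.
have hu : [set u | polyharmonic R p m n u /\
    restrict_Shat p u = zonal_sphere p m zeta] (zonal_poly p m zeta).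
  apply: xgetPex; case: hZ => -[u hu e] _; exists u; split => //.
case: hu => pu ue; case: hZ => _; rewrite -ue => hq.
rewrite /zonal (reproducing_unique hz pu hq) meval_zpoly mulrC.
have -> : qf (x 0) = cdot x x by apply: eq_bigr => j _; rewrite expr2.
have -> : qf (cj (zeta 0)) = cdot (cconj zeta) (cconj zeta).
  by apply: eq_bigr => j _; rewrite !mxE expr2.
by congr (zsum _ _ _ _ _); apply: eq_bigr => j _; rewrite mxE mulrC.
Qed.

End Zonal.

(** * The Gamma function at half-integers *)

Section HalfIntegerGamma.
Variable R : realType.
Local Notation leb := (@lebesgue_measure R).
Local Notation u := (@Num.sqrt R).

(** Euler's integral for [Gamma (m / 2 + 1)]. *)
Definition euler_half (m : nat) : \bar R :=
  (\int[leb]_(t in `[0%R, +oo[) (u t ^+ m * expR (- t))%:E)%E.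

Let continuous_u m : continuous (fun t : R => u t ^+ m).
Proof.
move=> t; apply: (@continuous_comp _ _ _ u (fun x => x ^+ m)).
  exact: sqrt_continuous.
exact: exprn_continuous.
Qed.

Let continuous_eN : continuous (fun t : R => expR (- t)).
Proof.
move=> t; apply: (@continuous_comp _ _ _ -%R expR).
  exact: oppr_continuous.
exact: continuous_expR.
Qed.

Let continuous_g m : continuous (fun t : R => u t ^+ m * expR (- t)).
Proof. by move=> t; exact: cvgM (@continuous_u m t) (@continuous_eN t). Qed.

Lemma measurable_euler_half m (D : set R) :
  measurable_fun D (fun t : R => (u t ^+ m * expR (- t))%:E).
Proof.
apply: measurable_funTS; apply/measurable_EFinP.
by apply: continuous_measurable_fun; exact: continuous_g.
Qed.

Lemma cvgy_euler_half m : (u t ^+ m * expR (- t)) @[t --> +oo%R] --> (0 : R).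
Proof.
apply/cvgrPdist_le => e e0; near=> t.
have t1 : 1 <= t by near: t; apply: nbhs_pinfty_ge; exact: num_real.
have t0 : 0 < t by rewrite (lt_le_trans _ t1).
have ht : (m.+1)`!%:R / e <= t by near: t; apply: nbhs_pinfty_ge; exact: num_real.
rewrite sub0r normrN ger0_norm ?mulr_ge0 ?exprn_ge0 ?sqrtr_ge0 ?expR_ge0//.
have u1 : 1 <= u t by rewrite -sqrtr1 ler_wsqrtr.
have ut : u t <= t.
  by rewrite -[X in _ <= X](sqr_sqrtr (ltW t0)) expr2 ler_peMl ?sqrtr_ge0.
apply: (@le_trans _ _ (t ^+ m * expR (- t))).
  apply: ler_wpM2r; first exact: expR_ge0.
  by apply: lerXn2r => //; rewrite nnegrE ?sqrtr_ge0// ltW.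
rewrite expRN ler_pdivrMr ?expR_gt0//.
apply: (@le_trans _ _ (e * (t ^+ m.+1 / (m.+1)`!%:R))); last first.
  by rewrite ler_pM2l// (le_trans _ (expR_ge1Dxn m (ltW t0)))// lerDr.
have f0 : 0 < (m.+1)`!%:R :> R by rewrite ltr0n fact_gt0.
rewrite exprSr -mulrA mulrCA; apply: ler_peMr; first by rewrite exprn_ge0 ?ltW.
by rewrite mulrA ler_pdivlMr// mul1r mulrC -ler_pdivrMr.
Unshelve. all: by end_near. Qed.

Let le_of_sqr_lt (v a : R) : 1 <= a -> v ^+ 2 < a -> v <= a.
Proof.
move=> a1 va; rewrite leNgt; apply/negP => av.
have h1 : a * a < v * v by apply: ltr_pM => //; lra.
have h2 : a <= a * a by apply: ler_peMl => //; lra.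
by move: va; rewrite expr2; lra.
Qed.

Lemma euler_half0 : euler_half 0 = 1%E.
Proof.
rewrite /euler_half; under eq_integral do rewrite expr0 mul1r.
rewrite (@ge0_continuous_FTC2y R _ (fun t => - expR (- t)) 0 0).
- by rewrite oppr0 expR0 -EFinB opprK add0r.
- by move=> x _; exact: expR_ge0.
- by apply: continuous_subspaceT; exact: continuous_eN.
- by rewrite -[X in _ --> X]oppr0; apply: cvgN; exact: cvgr_expR.
- by move=> x _; apply: ex_derive.
- by apply: cvg_at_right_filter; apply: cvgN; exact: continuous_eN.
- by move=> x _; rewrite derive1E derive_val mulrN1 opprK.
Qed.

(** Integrating by parts; adding a multiple of [expR (- t)] makes the integrand
    nonnegative, so that no integrability has to be known beforehand. *)
Lemma euler_halfSS m :
  euler_half m.+2 = ((m%:R / 2 + 1)%:E * euler_half m)%E.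
Proof.
set A := m%:R / 2 + 1; have A1 : 1 <= A by rewrite lerDr divr_ge0.
(* Where [u t ^+ 2 < A], also [u t <= A], so that [c] exceeds [A * u t ^+ m]. *)
pose c := A ^+ m.+1; have c0 : 0 <= c by rewrite exprn_ge0// (le_trans _ A1).
pose f (t : R) : R := (u t ^+ m.+2 + c - A * u t ^+ m) * expR (- t).
pose G (t : R) : R := - ((u t ^+ m.+2 + c) * expR (- t)).
have f0 t : 0 <= f t.
  rewrite mulr_ge0 ?expR_ge0// subr_ge0; have u0 := sqrtr_ge0 t.
  have [Au|uA] := leP A (u t ^+ 2).
    rewrite -[m.+2]addn2 exprD mulrC ler_wpDr// ler_wpM2l// exprn_ge0//.
  rewrite ler_wpDl ?exprn_ge0// /c exprS ler_wpM2l ?(le_trans _ A1)//.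
  apply: lerXn2r; rewrite ?nnegrE//; first by rewrite (le_trans _ A1).
  exact: le_of_sqr_lt.
have cf : continuous f.
  move=> t; apply: cvgM (@continuous_eN t).
  apply: cvgB; first exact: cvgD (@continuous_u m.+2 t) (cvg_cst c).
  exact: cvgM (cvg_cst A) (@continuous_u m t).
have cG : continuous G.
  move=> t; apply: cvgN; apply: cvgM (@continuous_eN t).
  exact: cvgD (@continuous_u m.+2 t) (cvg_cst c).
have dG (x : R) : 0 < x -> is_derive x 1 G (f x).
  move=> x0; have d1 := is_derive1_sqrt x0.
  have ux : u x != 0 by rewrite sqrtr_eq0 -ltNge.
  have d2 := is_deriveX m.+2 d1.
  have d3 : is_derive x 1 (fun t : R => expR (- t)) (- expR (- x)).
    by apply: is_derive_eq; rewrite mulrN1.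
  have d4 := is_deriveN (is_deriveM (is_deriveD d2 (is_derive_cst c x 1)) d3).
  have -> : G = - ((u ^+ m.+2 + cst c) * (fun t : R => expR (- t))).
    by apply/funext => t; rewrite /G !fctE.
  apply: is_derive_eq.
  rewrite !fctE -[LHS]/(- ((u x ^+ m.+2 + c) * - expR (- x)
    + expR (- x) * ((m.+2%:R * u x ^+ m.+1) * (2 * u x)^-1 + 0))) /f /A.
  move: (expR (- x)) => e; rewrite !exprS -natr1 -[m.+1%:R]natr1.
  by field.
have intf : (\int[leb]_(t in `[0%R, +oo[) (f t)%:E = c%:E)%E.
  rewrite (@ge0_continuous_FTC2y R _ G 0 0).
  - rewrite -EFinB /G sqrtr0 expr0n /= add0r oppr0 expR0 mulr1.
    by rewrite add0r opprK.
  - by move=> x _; exact: f0.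
  - exact: continuous_subspaceT.
  - have -> : G = - ((fun t => u t ^+ m.+2 * expR (- t))
                     + (fun=> c) \* (fun t : R => expR (- t))).
      by apply/funext => t; rewrite /G !fctE /= mulrDl.
    have -> : 0 = - (0 + c * 0) :> R by rewrite mulr0 addr0 oppr0.
    apply: cvgN; apply: cvgD; first exact: cvgy_euler_half.
    by apply: cvgM; [exact: cvg_cst|exact: cvgr_expR].
  - by move=> x x0; have dx := dG _ x0; apply: ex_derive.
  - by apply: cvg_at_right_filter; exact: cG.
  - move=> y; rewrite in_itv /= andbT => y0; have dx := dG y y0.
    by rewrite derive1E derive_val.
have ge m' (t : R) : (0 <= (u t ^+ m' * expR (- t))%:E)%E.
  by rewrite lee_fin mulr_ge0 ?expR_ge0// exprn_ge0// sqrtr_ge0.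
pose D : set R := `[0%R, +oo[%classic.
pose g m' (t : R) := (u t ^+ m' * expR (- t))%:E.
have mg m' := @measurable_euler_half m' D.
have mf : measurable_fun D (fun t => (f t)%:E).
  apply: measurable_funTS; apply/measurable_EFinP.
  exact: continuous_measurable_fun cf.
have mD : measurable D by exact: measurable_itv.
have sumD a (h : R -> \bar R) k : 0 <= a -> (forall t, 0 <= h t)%E ->
    measurable_fun D h ->
    (\int[leb]_(t in D) (h t + a%:E * g k t) =
     \int[leb]_(t in D) h t + a%:E * euler_half k)%E.
  move=> a0 h0 mh; rewrite ge0_integralD//.
  - by rewrite ge0_integralZl//; [exact: mg|move=> t _; exact: ge].
  - by move=> t _; rewrite mule_ge0 ?lee_fin//; exact: ge.
  - by apply: measurable_funeM; exact: mg.
have A0 : 0 <= A by exact: le_trans A1.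
have e : (c%:E + A%:E * euler_half m = euler_half m.+2 + c%:E * euler_half 0)%E.
  have fE t : (0 <= (f t)%:E)%E by rewrite lee_fin.
  rewrite -(sumD c _ 0%N c0 (ge m.+2) (mg m.+2)) -[X in (X + _ = _)%E]intf.
  rewrite -(sumD A _ m A0 fE mf); apply: eq_integral => t _; rewrite /g -!EFinM -!EFinD; congr EFin.
  by rewrite /f expr0; ring.
move: e; rewrite euler_half0 mule1 [LHS]addeC.
by move=> /(congr1 (fun z => z - c%:E)%E); rewrite !addeK.
Qed.

Let cubic_ge0 (v : R) : 0 <= v -> 0 <= 1 - v + v ^+ 3 / 4.
Proof.
move=> v0.
(* The minimum is at [2 / sqrt 3], close to [6 / 5]; with [12 / 5] the
   quadratic terms cancel. *)
have -> : 1 - v + v ^+ 3 / 4 =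
  (v + 12 / 5) * (v - 6 / 5) ^+ 2 / 4 + 2 / 25 * v + 17 / 125 by field.
have w0 := sqr_ge0 (v - 6 / 5).
have vw : 0 <= (v + 12 / 5) * (v - 6 / 5) ^+ 2 by apply: mulr_ge0 => //; lra.
by lra.
Qed.

(** The bounds [s <= 1 + s ^+ 2] and [s ^+ 2 <= s + s ^+ 4 / 4] for [s = u t]
    compare [euler_half 1] with values at even indices. *)
Lemma euler_half1 : exists2 r : R, 0 < r & euler_half 1 = r%:E.
Proof.
pose D : set R := `[0%R, +oo[%classic.
pose g m' (t : R) := (u t ^+ m' * expR (- t))%:E.
have mg m' := @measurable_euler_half m' D.
have mD : measurable D by exact: measurable_itv.
have ge m' (t : R) : (0 <= g m' t)%E.
  by rewrite lee_fin mulr_ge0 ?expR_ge0// exprn_ge0// sqrtr_ge0.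
have e2 : euler_half 2 = 1%E by rewrite euler_halfSS euler_half0 mul0r add0r mul1e.
have e4 : euler_half 4 = 2%E.
  by rewrite euler_halfSS e2 mule1 divff//; congr EFin; ring.
have le02 : (euler_half 1 <= euler_half 0 + euler_half 2)%E.
  rewrite -ge0_integralD//; try exact: mg; try by move=> t _; exact: ge.
  apply: ge0_le_integral => //; try exact: mg; try by move=> t _; exact: ge.
  - by apply: emeasurable_funD; exact: mg.
  - move=> t _; rewrite -EFinD lee_fin -mulrDl ler_wpM2r ?expR_ge0//.
    by have := sqrtr_ge0 t; generalize (u t) => v v0; rewrite expr0 expr1; nra.
have le14 : (euler_half 2 <= euler_half 1 + 4^-1%:E * euler_half 4)%E.
  rewrite -ge0_integralZl//; try exact: mg; try by move=> t _; exact: ge.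
  have mg4 : measurable_fun D (fun t => 4^-1%:E * g 4%N t)%E.
    by apply: measurable_funeM; exact: mg.
  have ge4 t : (0 <= 4^-1%:E * g 4%N t)%E by rewrite mule_ge0 ?lee_fin//; exact: ge.
  rewrite -ge0_integralD//; try exact: mg; try by move=> t _; exact: ge.
  apply: ge0_le_integral => //; try exact: mg; try by move=> t _; exact: ge.
  - by apply: emeasurable_funD; [exact: mg|apply: measurable_funeM; exact: mg].
  - move=> t _; rewrite -EFinM -EFinD lee_fin mulrA -mulrDl ler_wpM2r ?expR_ge0//.
    have := sqrtr_ge0 t; generalize (u t) => v v0.
    have -> : v ^+ 1 + 4^-1 * v ^+ 4 = v ^+ 2 + v * (1 - v + v ^+ 3 / 4) by field.
    rewrite lerDl mulr_ge0//.
    exact: cubic_ge0.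
move: le02 le14; rewrite euler_half0 e2 e4; case: (euler_half 1) => [r||]//.
rewrite -EFinM -!EFinD !lee_fin => _ h; exists r => //; lra.
Qed.

Lemma euler_half_gt0 m : exists2 r : R, 0 < r & euler_half m = r%:E.
Proof.
suff : (exists2 r : R, 0 < r & euler_half m = r%:E) /\
       (exists2 r : R, 0 < r & euler_half m.+1 = r%:E) by case.
elim: m => [|m [[r r0 er] IH]].
  by split; [exists 1 => //; exact: euler_half0|exact: euler_half1].
split => //; exists ((m%:R / 2 + 1) * r); last by rewrite euler_halfSS er.
by rewrite mulr_gt0// ltr_pwDr// divr_ge0.
Qed.

Lemma Gamma_half m : Gamma (m.+2%:R / 2 : R) = fine (euler_half m).
Proof.
rewrite /Gamma divr_gt0 ?ltr0n//= /Rintegral; congr fine.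
rewrite /euler_half -integral_itv_obnd_cbnd; last exact: measurable_euler_half.
apply: eq_integral => t; rewrite inE /= in_itv /= andbT => t0.
congr (_ * _)%:E; have -> : m.+2%:R / 2 - 1 = 2^-1 * m%:R :> R.
  by rewrite -[m.+2]addn2 natrD; field.
by rewrite powRrM powR12_sqrt ?ltW// powR_mulrn// sqrtr_ge0.
Qed.

Lemma Gamma_half_gt0 m : 0 < Gamma (m.+2%:R / 2 : R).
Proof. by rewrite Gamma_half; have [r r0 ->] := euler_half_gt0 m. Qed.

Lemma Gamma_half_rise m j : (1 < m)%N ->
  Gamma ((m + 2 * j)%:R / 2 : R) = rise R m j / 2 ^+ j * Gamma (m%:R / 2).
Proof.
case: m => [|[|m]]// _; elim: j => [|j IH].
  by rewrite addn0 /rise big_ord0 expr0 divr1 mul1r.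
have -> : (m.+2 + 2 * j.+1 = (m + 2 * j).+2.+2)%N by lia.
move: IH; rewrite -[(m.+2 + 2 * j)%N]/(m + 2 * j).+2 !Gamma_half euler_halfSS.
have [r _ ->] := euler_half_gt0 (m + 2 * j); rewrite -EFinM /= => ->.
rewrite riseS exprS.
by field; rewrite expf_neq0.
Qed.

Lemma gegenbauer_coefE n m k : (1 < n)%N -> (2 * k <= m)%N ->
  gegenbauer_coef (n%:R / 2 : R) m k * 2 ^+ (m - 2 * k) = gcoef R n m k.
Proof.
move=> n1 km; rewrite /gegenbauer_coef /gcoef km.
have -> : m%:R + n%:R / 2 - k%:R = (n + 2 * (m - k))%:R / 2 :> R.
  by rewrite natrD natrM natrB; [field|lia].
rewrite Gamma_half_rise//.
have G0 : Gamma (n%:R / 2 : R) != 0.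
  by case: n n1 => [|[|n]]// _; rewrite gt_eqF// Gamma_half_gt0.
have -> : (m - k = (m - 2 * k) + k)%N by lia.
rewrite [in 2 ^+ (_ + k)]exprD.
by field; rewrite ?G0 ?expf_neq0 ?pnatr_eq0 -?lt0n ?fact_gt0.
Qed.

End HalfIntegerGamma.

(** * Truncations of the generating function *)

Section GeneratingFunction.
Variable F : numFieldType.
Implicit Types (p q r : {poly F}) (z : F).

Lemma gsum_rec n m (s P : F) :
  m.+2%:R * gsum n m.+2 s P =
  (n%:R + 2 * m.+1%:R) * s * gsum n m.+1 s P - (n + m)%:R * P * gsum n m s P.
Proof.
rewrite /gsum mulr_sumr.
rewrite (eq_bigr (fun k : 'I_m.+3 =>
    (n%:R + 2 * m.+1%:R) * s * (gcoef F n m.+1 k * s ^+ (m.+1 - 2 * k) * P ^+ k)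
    - (if nat_of_ord k is k'.+1 then (n + m)%:R * gcoef F n m k' else 0)
      * s ^+ (m.+2 - 2 * k) * P ^+ k)) => [|k _]; last first.
  rewrite !mulrA gcoef_rec3 !mulrBl; congr (_ - _).
  have [km|mk] := leqP (2 * k) m.+1; last by rewrite gcoef_gt// !(mulr0, mul0r).
  rewrite (_ : (m.+2 - 2 * k = (m.+1 - 2 * k).+1)%N) ?exprS; last by lia.
  by ring.
rewrite big_split sumrN -mulr_sumr /=; congr (_ * _ - _).
  by rewrite big_ord_recr /= gcoef_gt ?mul0r ?addr0//; lia.
rewrite big_ord_recl /= !mul0r add0r big_ord_recr /= gcoef_gt ?mulr0 ?mul0r ?addr0; last by lia.
rewrite mulr_sumr; apply: eq_bigr => k _; rewrite /bump leq0n add1n.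
rewrite (_ : (m.+2 - 2 * k.+1 = m - 2 * k)%N) ?exprS; last by lia.
by ring.
Qed.

Lemma gsum0 n (s P : F) : gsum n 0 s P = 1.
Proof. by rewrite /gsum big_ord1 gcoef00 !expr0 !mulr1. Qed.

Lemma gsum1 n (s P : F) : gsum n 1 s P = n%:R * s.
Proof.
rewrite /gsum big_ord_recl big_ord1 /= [gcoef F n 1 (bump 0 0)]gcoef_gt//.
rewrite !mul0r addr0 mulr1 (gcoefE F n 1 0) /rise big_ord_recl big_ord0.
by rewrite !expr0 !mulr1 !mul1r mulr0 addr0 divr1.
Qed.

(** The coefficients of the series of [(1 - t) ^ (- 1 / 2)]. *)
Definition acoef (d : nat) : F := \prod_(i < d) ((2 * i + 1)%:R / (2 * i + 2)%:R).

Lemma acoefS d : acoef d.+1 = acoef d * ((2 * d + 1)%:R / (2 * d + 2)%:R).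
Proof. by rewrite /acoef big_ord_recr. Qed.

Lemma acoef_ge0 d : 0 <= acoef d.
Proof. by apply: prodr_ge0 => i _; rewrite divr_ge0. Qed.

Lemma acoef_decr d : acoef d.+1 <= acoef d.
Proof.
rewrite acoefS ler_piMr ?acoef_ge0// ler_pdivrMr ?ltr0n ?addn_gt0 ?orbT//.
by rewrite mul1r ler_nat; lia.
Qed.

Lemma acoef_le1 d : acoef d <= 1.
Proof.
elim: d => [|d IH]; first by rewrite /acoef big_ord0.
exact: le_trans (acoef_decr d) IH.
Qed.

Definition apoly N z : {poly F} := \poly_(i < N) (acoef i * z ^+ i).

Definition vanish_below k p : Prop := forall i, (i < k)%N -> p`_i = 0.

Lemma vanish_belowMl k p q : vanish_below k p -> vanish_below k (p * q).
Proof.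
move=> pk i ik; rewrite coefM big1// => j _; rewrite pk ?mul0r//.
by rewrite (leq_ltn_trans _ ik)// -ltnS.
Qed.

Lemma vanish_belowD k p q : vanish_below k p -> vanish_below k q -> vanish_below k (p + q).
Proof. by move=> pk qk i ik; rewrite coefD pk ?qk ?addr0. Qed.

(** The truncated form of the differential equation
    [(1 - z t) y' = (z / 2) y] of [y = (1 - z t) ^ (- 1 / 2)]. *)
Lemma apoly_ode N z :
  vanish_below N.-1 ((apoly N z)^`() * (1 - z *: 'X) - (z / 2) *: apoly N z).
Proof.
case: N => [|N] i //= iN.
rewrite mulrBr mulr1 -scalerAr !coefB !coefZ coefMX !coef_deriv !coef_poly.
rewrite ltnS iN (ltn_trans iN)//.
have -> : (if i == 0%N then 0
    else (if (i.-1.+1 < N.+1)%N then acoef i.-1.+1 * z ^+ i.-1.+1 else 0) *+ i.-1.+1)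
    = (acoef i * z ^+ i) *+ i.
  by case: i iN => [|i] iN /=; rewrite ?mulr0n// ltnS ltnW.
rewrite acoefS exprS -mulr_natl -[_ *+ i]mulr_natl.
by field; rewrite -natrM -natrD pnatr_eq0 addn2.
Qed.

Definition gpow N n z1 z2 : {poly F} := (apoly N z1 * apoly N z2) ^+ n.

(** The product rule applied to [apoly_ode], as
    [(1 - z1 t) (1 - z2 t) = 1 - 2 s t + P t^2]. *)
Lemma gpow_ode N n z1 z2 (s := (z1 + z2) / 2) (P := z1 * z2) :
  vanish_below N.-1 ((gpow N n z1 z2)^`() * (1 - (2 * s) *: 'X + P *: 'X^2)
             - n%:R *: (s%:P - P *: 'X) * gpow N n z1 z2).
Proof.
set A1 := apoly N z1; set A2 := apoly N z2.
set r1 := A1^`() * (1 - z1 *: 'X) - (z1 / 2) *: A1.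
set r2 := A2^`() * (1 - z2 *: 'X) - (z2 / 2) *: A2.
have -> : (gpow N n z1 z2)^`() * (1 - (2 * s) *: 'X + P *: 'X^2)
      - n%:R *: (s%:P - P *: 'X) * gpow N n z1 z2 =
    r1 * (n%:R *: ((A1 * A2) ^+ n.-1 * A2 * (1 - z2 *: 'X)))
    + r2 * (n%:R *: ((A1 * A2) ^+ n.-1 * A1 * (1 - z1 *: 'X))).
  rewrite /gpow -/A1 -/A2 deriv_exp derivM -scaler_nat.
  case: n => [|n]; first by rewrite !scale0r !mul0r !mulr0 subrr addr0.
  rewrite /= [_ ^+ n.+1]exprS /r1 /r2 -!mul_polyC.
  have -> : (2 * s)%:P = z1%:P + z2%:P :> {poly F}.
    by rewrite -polyCD; congr _%:P; rewrite /s; field.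
  have -> : P%:P = z1%:P * z2%:P :> {poly F} by rewrite -polyCM.
  have -> : s%:P = (z1 / 2)%:P + (z2 / 2)%:P :> {poly F}.
    by rewrite -polyCD; congr _%:P; rewrite /s; field.
  have e1 : z1%:P = (z1 / 2)%:P *+ 2 :> {poly F}.
    by rewrite -polyCMn; congr _%:P; rewrite -mulr_natr; field.
  have e2 : z2%:P = (z2 / 2)%:P *+ 2 :> {poly F}.
    by rewrite -polyCMn; congr _%:P; rewrite -mulr_natr; field.
  rewrite e1 e2; move: (z1 / 2)%:P (z2 / 2)%:P (A1^`()) (A2^`()) => a b d1 d2.
  move: ((A1 * A2) ^+ n) (A1) (A2) (n.+1%:R)%:P => G B1 B2 c.
  by ring.
by apply: vanish_belowD; apply: vanish_belowMl; exact: apoly_ode.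
Qed.

Lemma ode_expand p c s P n :
  p^`() * (1 - c *: 'X + P *: 'X^2) - n%:R *: (s%:P - P *: 'X) * p =
  p^`() - c *: (p^`() * 'X) + P *: (p^`() * 'X * 'X)
  - (n%:R * s) *: p + (n%:R * P) *: (p * 'X).
Proof. by rewrite -!mul_polyC !polyCM; ring. Qed.

Lemma apoly0 N z : (0 < N)%N -> (apoly N z)`_0 = 1.
Proof. by move=> N0; rewrite coef_poly N0 /acoef big_ord0 expr0 mulr1. Qed.

Lemma coef0_exp p n : (p ^+ n)`_0 = p`_0 ^+ n.
Proof. by elim: n => [|n IH]; rewrite ?expr0 ?coefC// !exprS coefM big_ord1 IH. Qed.

(** Read off from [gpow_ode], the coefficients satisfy the recurrence
    [gsum_rec]. *)
Lemma coef_gpow N n z1 z2 d : (d < N)%N ->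
  (gpow N n z1 z2)`_d = gsum n d ((z1 + z2) / 2) (z1 * z2).
Proof.
have [m] := ubnP d; elim: m d => // m IH [|[|d]] dm dN.
- by rewrite gsum0 /gpow coef0_exp coefM big_ord1 !apoly0// mulr1 expr1n.
- have := @gpow_ode N n z1 z2 0%N; rewrite -ltnS (ltn_predK dN) => /(_ dN).
  rewrite ode_expand !(coefD, coefN, coefZ) !coefMX /= !coef_deriv mulr1n !mulr0.
  rewrite !(addr0, oppr0) => /eqP; rewrite subr_eq0 => /eqP ->.
  by rewrite (IH 0%N)// ?gsum0 ?gsum1 ?mulr1//; exact: ltn_trans dN.
- have := @gpow_ode N n z1 z2 d.+1; rewrite -ltnS (ltn_predK dN) => /(_ dN).
  rewrite ode_expand !(coefD, coefN, coefZ) !coefMX /= !coef_deriv.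
  rewrite (IH d.+1)//; last by rewrite (ltn_trans _ dN).
  have hd : (gpow N n z1 z2)`_d = gsum n d ((z1 + z2) / 2) (z1 * z2).
    by apply: IH; lia.
  rewrite hd => e; have d0 : d.+2%:R != 0 :> F by rewrite pnatr_eq0.
  apply: (mulfI d0); rewrite gsum_rec.
  set s := (z1 + z2) / 2 in e hd *; set P := z1 * z2 in e hd *.
  apply/eqP; rewrite -subr_eq0; apply/eqP; rewrite -[RHS]e.
  move: (gpow N n z1 z2)`_d.+2 => V; case: d {IH dm dN d0 e} hd => [|d] /= hd.
    by rewrite gsum0 gsum1; ring.
  rewrite hd; move: (gsum n d.+2 s P) (gsum n d.+1 s P) => x y.
  by rewrite -[V *+ d.+3]mulr_natl -[x *+ d.+2]mulr_natl -[y *+ d.+1]mulr_natl; ring.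
Qed.

End GeneratingFunction.

Section TailBound.
Variable F : numFieldType.
Implicit Types (p q W : {poly F}) (z rho t : F).

Definition dominated p W : Prop := forall i, `|p`_i| <= W`_i.

Lemma dominatedM p q V W : dominated p V -> dominated q W -> dominated (p * q) (V * W).
Proof.
move=> pV qW i; rewrite !coefM; apply: le_trans (ler_norm_sum _ _ _) _.
by apply: ler_sum => j _; rewrite normrM ler_pM.
Qed.

Lemma dominatedX p W n : dominated p W -> dominated (p ^+ n) (W ^+ n).
Proof.
move=> pW; elim: n => [|n IH]; last by rewrite !exprS; exact: dominatedM.
by move=> i; rewrite !expr0 coefC; case: eqP => _; rewrite ?normr1 ?normr0.
Qed.

(** Each coefficient of the majorant beyond [N] is at most [t ^- N] times the
    corresponding term of its value at [t]. *)
Lemma dominated_tail p W N t : dominated p W -> 1 <= t ->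
  `|p.[1] - \sum_(i < N) p`_i| <= W.[t] / t ^+ N.
Proof.
move=> pW t1; have t0 : 0 < t by rewrite (lt_le_trans _ t1).
have W0 i : 0 <= W`_i by rewrite (le_trans _ (pW i)).
rewrite ler_pdivlMr ?exprn_gt0//.
have [M /andP[pM WM]] : exists M, (size p <= N + M)%N && (size W <= N + M)%N.
  by exists (size p + size W)%N; lia.
rewrite (horner_coef_wide 1 pM) (horner_coef_wide t WM).
rewrite !big_split_ord /=.
rewrite (eq_bigr (fun i : 'I_N => p`_i)) => [|i _]; last by rewrite expr1n mulr1.
rewrite addrAC subrr add0r.
apply: (@le_trans _ _ (\sum_(i < M) W`_(N + i) * t ^+ (N + i))); last first.
  by rewrite lerDr sumr_ge0// => i _; rewrite mulr_ge0// exprn_ge0// ltW.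
apply: (@le_trans _ _ (\sum_(i < M) W`_(N + i) * t ^+ N)).
  rewrite -mulr_suml; apply: ler_wpM2r; first by rewrite exprn_ge0 // ltW.
  apply: le_trans (ler_norm_sum _ _ _) _; apply: ler_sum => i _.
  by rewrite expr1n mulr1.
apply: ler_sum => i _; apply: ler_wpM2l => //; rewrite exprD ler_peMr//.
  by rewrite exprn_ge0// ltW.
by rewrite exprn_ege1.
Qed.

Lemma apoly_dominated N z rho : `|z| <= rho ->
  dominated (apoly N z) (\poly_(i < N) rho ^+ i).
Proof.
move=> zr i; have r0 : 0 <= rho by exact: le_trans zr.
rewrite !coef_poly; case: ifP => _; last by rewrite normr0.
rewrite normrM normrX (ger0_norm (acoef_ge0 F i)).
apply: le_trans (_ : 1 * `|z| ^+ i <= _); first by rewrite ler_wpM2r ?exprn_ge0 ?acoef_le1.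
by rewrite mul1r lerXn2r// nnegrE.
Qed.

Lemma geometric_poly_le N rho t : 0 <= rho * t -> rho * t < 1 ->
  0 <= (\poly_(i < N) rho ^+ i).[t] <= (1 - rho * t)^-1.
Proof.
move=> r0 r1; rewrite horner_poly.
rewrite (eq_bigr (fun i : 'I_N => (rho * t) ^+ i)) => [|i _]; last by rewrite exprMn.
rewrite sumr_ge0 => [|i _]; last by rewrite exprn_ge0.
have h : 0 < 1 - rho * t by rewrite subr_gt0.
rewrite /= -[leRHS]mul1r ler_pdivlMr// mulrC.
have := subrX1 (rho * t) N; rewrite -opprB -[X in _ = X * _]opprB mulNr => /oppr_inj <-.
by rewrite lerBlDr lerDl exprn_ge0.
Qed.

(** The geometric polynomials with ratio [rho] dominate both truncations, and
    their values at [t] are bounded uniformly in [N]. *)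
Lemma gpow_tail N n z1 z2 rho t : `|z1| <= rho -> `|z2| <= rho -> 1 <= t ->
  rho * t < 1 ->
  `|(gpow N n z1 z2).[1] - \sum_(d < N) gsum n d ((z1 + z2) / 2) (z1 * z2)|
    <= (1 - rho * t)^-1 ^+ (2 * n) / t ^+ N.
Proof.
move=> h1 h2 t1 rt; have t0 : 0 < t by rewrite (lt_le_trans _ t1).
have r0 : 0 <= rho by exact: le_trans h1.
have dom : dominated (gpow N n z1 z2)
    ((\poly_(i < N) rho ^+ i * \poly_(i < N) rho ^+ i) ^+ n).
  by apply: dominatedX; apply: dominatedM; exact: apoly_dominated.
rewrite (eq_bigr (fun d : 'I_N => (gpow N n z1 z2)`_d)) => [|d _]; last first.
  by rewrite coef_gpow.
apply: le_trans (dominated_tail N dom t1) _.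
rewrite ler_pM2r ?invr_gt0 ?exprn_gt0// horner_exp hornerM -expr2 -exprM.
have /andP[g0 g1] := @geometric_poly_le N rho t (mulr_ge0 r0 (ltW t0)) rt.
by rewrite lerXn2r// nnegrE ?invr_ge0// subr_ge0 ltW.
Qed.

(** [(1 - z) * (apoly N z).[1]] approximates [(1 - z) ^ (1 / 2)]; by summation
    by parts its difference from 1 is a convex combination of positive powers of
    [z]. *)
Lemma apoly_near1 N z rho : `|z| <= rho -> rho <= 1 -> (0 < N)%N ->
  `|1 - (1 - z) * (apoly N z).[1]| <= rho.
Proof.
move=> zr r1; case: N => // N _; have r0 : 0 <= rho by exact: le_trans zr.
have hz i : (0 < i)%N -> `|z ^+ i| <= rho.
  case: i => // i _; rewrite normrX exprS -[leRHS]mulr1 ler_pM ?exprn_ge0//.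
  by rewrite exprn_ile1// (le_trans zr).
have hE M : (apoly M z).[1] = \sum_(i < M) acoef F i * z ^+ i.
  by rewrite horner_poly; apply: eq_bigr => i _; rewrite expr1n mulr1.
have key : `|1 - (1 - z) * (apoly N.+1 z).[1] - acoef F N * z ^+ N.+1|
    <= rho * (1 - acoef F N).
  elim: N => [|N IH].
    rewrite hE big_ord1 /acoef big_ord0 expr0 expr1 !mulr1 mul1r subrr mulr0.
    by rewrite opprB addrCA subrr addr0 subrr normr0.
  rewrite hE big_ord_recr -hE /=.
  have -> : 1 - (1 - z) * ((apoly N.+1 z).[1] + acoef F N.+1 * z ^+ N.+1)
        - acoef F N.+1 * z ^+ N.+2 =
      (1 - (1 - z) * (apoly N.+1 z).[1] - acoef F N * z ^+ N.+1)
      + (acoef F N - acoef F N.+1) * z ^+ N.+1.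
    by rewrite [z ^+ N.+2]exprS; ring.
  have a0 : 0 <= acoef F N - acoef F N.+1 by rewrite subr_ge0 acoef_decr.
  apply: le_trans (ler_normD _ _) _.
  have -> : rho * (1 - acoef F N.+1) =
    rho * (1 - acoef F N) + (acoef F N - acoef F N.+1) * rho by ring.
  by apply: lerD => //; rewrite normrM (ger0_norm a0) ler_wpM2l// hz.
have -> : 1 - (1 - z) * (apoly N.+1 z).[1] =
  (1 - (1 - z) * (apoly N.+1 z).[1] - acoef F N * z ^+ N.+1)
  + acoef F N * z ^+ N.+1 by rewrite subrK.
apply: le_trans (ler_normD _ _) _.
have -> : rho = rho * (1 - acoef F N) + acoef F N * rho by ring.
by apply: lerD => //; rewrite normrM (ger0_norm (acoef_ge0 _ _)) ler_wpM2l ?acoef_ge0 ?hz.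
Qed.

(** With [n = 2] and [z2 = 0] the generating function is [1 / (1 - z t)]. *)
Lemma gsum_geometric d z : gsum 2 d (z / 2) 0 = z ^+ d.
Proof.
have [m] := ubnP d; elim: m d => // m IH [|[|d]] dm.
- by rewrite gsum0 expr0.
- by rewrite gsum1 expr1 mulrC divfK.
- have d0 : d.+2%:R != 0 :> F by rewrite pnatr_eq0.
  apply: (mulfI d0); rewrite gsum_rec mulr0 mul0r subr0 IH; last by lia.
  by rewrite [z ^+ d.+2]exprS; field.
Qed.

Lemma apoly_sqr_tail N z rho t : (0 < N)%N -> `|z| <= rho -> 1 <= t -> rho * t < 1 ->
  `|(apoly N z).[1] ^+ 2 - \sum_(d < N) z ^+ d|
    <= (1 - rho * t)^-1 ^+ 4 / t ^+ N.
Proof.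
move=> N0 zr t1 rt; have r0 : 0 <= rho by exact: le_trans zr.
have z0 : `|0 : F| <= rho by rewrite normr0.
have := gpow_tail N 2 zr z0 t1 rt; rewrite addr0 mulr0.
under eq_bigr do rewrite gsum_geometric.
suff -> : (gpow N 2 z 0).[1] = (apoly N z).[1] ^+ 2 by [].
have a1 : apoly N (0 : F) = 1.
  apply/polyP => i; rewrite coef_poly coefC; case: i => [|i].
    by rewrite N0 /acoef big_ord0 expr0 mulr1.
  by rewrite expr0n mulr0 if_same.
by rewrite /gpow a1 mulr1 horner_exp.
Qed.

End TailBound.

(** * Summation of the Gegenbauer series *)

Section ComplexSeries.
Variable R : realType.
Local Notation C := (R[i]^o).
Implicit Types (u : nat -> C) (z l : R[i]).

Lemma pos_complexP (e : R[i]) : 0 < e -> exists2 r : R, 0 < r & e = r%:C.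
Proof.
by case: e => a b; rewrite ltcE /= => /andP[/eqP b0 a0]; exists a => //; rewrite b0.
Qed.

Let ReD (x y : R[i]) : complex.Re (x + y) = complex.Re x + complex.Re y.
Proof. by case: x y => [a b] [c d]. Qed.

Let ReB (x y : R[i]) : complex.Re (x - y) = complex.Re x - complex.Re y.
Proof. by case: x y => [a b] [c d]. Qed.

Lemma cvg_bound u l (e : nat -> R) :
  (forall N, (0 < N)%N -> `|l - u N| <= (e N)%:C) ->
  e @ \oo --> (0 : R) -> u @ \oo --> (l : C).
Proof.
move=> ul e0; apply/(@cvgrPdist_le _ C) => _ /pos_complexP[r r0 ->].
have /cvgrPdist_le/(_ _ r0) := e0; apply: filterS2 (nbhs_infty_gt 0) => N N0.
rewrite sub0r normrN => er; apply: le_trans (ul _ N0) _.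
by rewrite lecR (le_trans (ler_norm _)).
Qed.

Lemma cvg_expc z (rho : R) : rho < 1 -> `|z| <= rho%:C ->
  (fun N => z ^+ N : C) @ \oo --> (0 : C).
Proof.
move=> r1 zr; have r0 : 0 <= rho by rewrite -ler0c (le_trans _ zr).
apply: (@cvg_bound _ _ (fun N => rho ^+ N)).
  by move=> N _; rewrite sub0r normrN normrX rmorphXn lerXn2r// nnegrE ler0c.
by apply: cvg_expr; rewrite ger0_norm.
Qed.

Lemma cvg_geo (u : nat -> C) l (c rho : R) : 0 <= rho < 1 ->
  (forall N, (0 < N)%N -> `|l - u N| <= (c * rho ^+ N)%:C) -> u @ \oo --> (l : C).
Proof.
move=> /andP[r0 r1] h; apply: (cvg_bound h).
rewrite -[X in _ --> X](mulr0 c); apply: cvgM; first exact: cvg_cst.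
by apply: cvg_expr; rewrite ger0_norm.
Qed.

(** The harmonic mean of 1 and [1 / rho] as the point at which majorants are
    evaluated; its inverse is the resulting rate of convergence. *)
Lemma comparison_point (rho : R) : 0 <= rho -> rho < 1 ->
  [/\ 1 <= (2 / (1 + rho))%:C, rho%:C * (2 / (1 + rho))%:C < 1 &
      0 <= (1 + rho) / 2 < 1].
Proof.
move=> r0 r1; have d0 : 0 < 1 + rho by lra.
split; last by apply/andP; split; lra.
  by rewrite (lecR 1) ler_pdivlMr// mul1r; lra.
by rewrite -rmorphM (ltcR _ 1) mulrA ltr_pdivrMr// mul1r; lra.
Qed.

Lemma real_bound (a t : R) m N : ((1 - a * t)^-1 ^+ m / t ^+ N)%:C =
  (1 - a%:C * t%:C)^-1 ^+ m / t%:C ^+ N.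
Proof.
rewrite fmorph_div; congr (_ / _); last exact: rmorphXn.
by rewrite rmorphXn; congr (_ ^+ _); rewrite fmorphV rmorphB rmorphM rmorph1.
Qed.

Lemma cvg_gpow_sum n z1 z2 (rho : R) : rho < 1 ->
  `|z1| <= rho%:C -> `|z2| <= rho%:C ->
  (fun N => (gpow N n z1 z2).[1]
     - \sum_(d < N) gsum n d ((z1 + z2) / 2) (z1 * z2) : C) @ \oo --> (0 : C).
Proof.
move=> r1 h1 h2; have r0 : 0 <= rho by rewrite -ler0c (le_trans _ h1).
have [t1 rt tau] := comparison_point r0 r1.
apply: (cvg_geo (c := (1 - rho * (2 / (1 + rho)))^-1 ^+ (2 * n)) tau) => N _.
rewrite sub0r normrN; apply: le_trans (gpow_tail N n h1 h2 t1 rt) _.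
by rewrite -[(1 + rho) / 2]invf_div [_^-1 ^+ N]exprVn real_bound.
Qed.

(** The square of [(1 - z) * (apoly N z).[1]] tends to [1 - z] by the case of the
    geometric series. By [apoly_near1] its real part is at least [1 - rho], so its
    sum with [k] stays away from zero; hence its difference from [k] tends to
    zero together with the difference of the squares. *)
Lemma cvg_apoly z (rho : R) (k : R[i]) : rho < 1 -> `|z| <= rho%:C ->
  k ^+ 2 = 1 - z -> 0 < complex.Re k ->
  (fun N => (apoly N z).[1] : C) @ \oo --> (k^-1 : C).
Proof.
move=> r1 zr k2 k0; have r0 : 0 <= rho by rewrite -ler0c (le_trans _ zr).
have k_neq0 : k != 0 by apply/eqP => e; move: k0; rewrite e ltxx.
have z1 : 1 - z != 0 by rewrite -k2 expf_neq0.
have sq : (fun N => ((1 - z) * (apoly N z).[1]) ^+ 2 : C) @ \oo --> (k ^+ 2 : C).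
  have [t1 rt tau] := comparison_point r0 r1.
  have h : (fun N => (apoly N z).[1] ^+ 2 - \sum_(d < N) z ^+ d : C) @ \oo
      --> (0 : C).
    apply: (cvg_geo (c := (1 - rho * (2 / (1 + rho)))^-1 ^+ 4) tau) => N N0.
    rewrite sub0r normrN; apply: le_trans (apoly_sqr_tail N0 zr t1 rt) _.
    by rewrite -[(1 + rho) / 2]invf_div [_^-1 ^+ N]exprVn real_bound.
  have -> : (fun N => ((1 - z) * (apoly N z).[1]) ^+ 2 : C) =
      (fun N => (1 - z) ^+ 2 * ((apoly N z).[1] ^+ 2 - \sum_(d < N) z ^+ d)
                + (1 - z) * (1 - z ^+ N)).
    apply/funext => N; rewrite exprMn.
    have -> : 1 - z ^+ N = (1 - z) * \sum_(d < N) z ^+ d.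
      by rewrite -opprB subrX1 -mulNr opprB.
    by ring.
  have -> : k ^+ 2 = (1 - z) ^+ 2 * 0 + (1 - z) * (1 - 0) by rewrite k2; ring.
  apply: (@cvgD _ C); apply: (@cvgM R[i]); [exact: cvg_cst|exact: h|exact: cvg_cst|].
  by apply: (@cvgB _ C); [exact: cvg_cst|exact: cvg_expc zr].
have lim : (fun N => (1 - z) * (apoly N z).[1] : C) @ \oo --> (k : C).
  apply/(@cvgrPdist_le _ C) => _ /pos_complexP[e e0 ->].
  have d0 : 0 < 1 - rho by rewrite subr_gt0.
  have ed0 : 0 < (e * (1 - rho))%:C :> R[i] by rewrite ltcR mulr_gt0.
  have /(@cvgrPdist_le _ C)/(_ _ ed0) := sq.
  apply: filterS2 (nbhs_infty_gt 0) => N N0; set kN := (1 - z) * _ => h.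
  have r1C : rho%:C <= 1 by rewrite (lecR _ 1) ltW.
  have near1 := apoly_near1 zr r1C N0.
  have Rk : 1 - rho <= complex.Re (k + kN).
    have := le_trans (normc_ge_Re _) near1; rewrite lecR -/kN.
    by rewrite ReD ReB /= => /ler_normlP[_ h1]; lra.
  have : (1 - rho)%:C <= `|k + kN|.
    apply: le_trans (normc_ge_Re _); rewrite lecR; apply: le_trans Rk _.
    exact: ler_norm.
  move=> h2; have d0C : 0 < (1 - rho)%:C by rewrite ltcR.
  rewrite -(ler_pM2r d0C).
  have -> : e%:C * (1 - rho)%:C = (e * (1 - rho))%:C by rewrite rmorphM.
  by apply: le_trans h; rewrite subr_sqr normrM ler_wpM2l.
have -> : (fun N => (apoly N z).[1] : C) =
    (fun N => (1 - z)^-1 * ((1 - z) * (apoly N z).[1])).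
  by apply/funext => N; rewrite mulKf.
have -> : k^-1 = (1 - z)^-1 * k by rewrite -k2 expr2 invfM mulfVK.
by apply: (@cvgM R[i]); [exact: cvg_cst|exact: lim].
Qed.

Lemma cvg_gsum n z1 z2 (rho : R) (k1 k2 : R[i]) : rho < 1 ->
  `|z1| <= rho%:C -> `|z2| <= rho%:C ->
  k1 ^+ 2 = 1 - z1 -> 0 < complex.Re k1 -> k2 ^+ 2 = 1 - z2 -> 0 < complex.Re k2 ->
  (fun N => \sum_(d < N) gsum n d ((z1 + z2) / 2) (z1 * z2) : C) @ \oo
    --> (((k1 * k2) ^+ n)^-1 : C).
Proof.
move=> r1 h1 h2 k1E k10 k2E k20.
have -> : (fun N => \sum_(d < N) gsum n d ((z1 + z2) / 2) (z1 * z2) : C) =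
    (fun N => ((apoly N z1).[1] * (apoly N z2).[1]) ^+ n
       - ((gpow N n z1 z2).[1] - \sum_(d < N) gsum n d ((z1 + z2) / 2) (z1 * z2))).
  by apply/funext => N; rewrite /gpow horner_exp hornerM subKr.
rewrite -[X in _ --> X]subr0; apply: (@cvgB _ C); last exact: cvg_gpow_sum h1 h2.
have h : (fun N => (apoly N z1).[1] * (apoly N z2).[1] : C) @ \oo
    --> ((k1 * k2)^-1 : C).
  by rewrite invfM; apply: (@cvgM R[i]); [exact: cvg_apoly h1 _ _|exact: cvg_apoly h2 _ _].
rewrite -exprVn; elim: n => [|n IH].
  rewrite expr0 (_ : (fun N => _) = fun=> 1); first exact: cvg_cst.
  by apply/funext => N; rewrite expr0.
rewrite exprS (_ : (fun N => _) = fun N => (apoly N z1).[1] * (apoly N z2).[1] *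
   ((apoly N z1).[1] * (apoly N z2).[1]) ^+ n); last by apply/funext => N; rewrite exprS.
by apply: (@cvgM R[i]); [exact: h|exact: IH].
Qed.

End ComplexSeries.

(** * The Poisson kernel *)

Section PrincipalPower.
Variable R : realType.

Lemma de_moivre (phi : R) n :
  (cos phi +i* sin phi) ^+ n = cos (n%:R * phi) +i* sin (n%:R * phi).
Proof.
elim: n => [|n IH]; first by rewrite expr0 mul0r cos0 sin0.
rewrite exprS IH -natr1 mulrDl mul1r [n%:R * phi + phi]addrC cosD sinD.
by simpc; congr (_ +i* _); rewrite addrC.
Qed.

(** On the right half-plane the argument doubles without leaving the range of
    the principal argument. *)
Lemma cpow_sqr (v : R[i]) n : 0 < complex.Re v ->
  cpow (v ^+ 2) (n%:R / 2) = v ^+ n.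
Proof.
case: v => a b /= a0; set r := Num.sqrt (a ^+ 2 + b ^+ 2).
have ab0 : 0 < a ^+ 2 + b ^+ 2 by rewrite ltr_pwDl// ?sqr_ge0// exprn_gt0.
have r0 : 0 < r by rewrite sqrtr_gt0.
have rr : r ^+ 2 = a ^+ 2 + b ^+ 2 by rewrite sqr_sqrtr// ltW.
have r_neq0 : r != 0 by rewrite gt_eqF.
have br : -1 <= b / r <= 1.
  rewrite -ler_norml normrM normfV (gtr0_norm r0) ler_pdivrMr// mul1r.
  by rewrite -sqrtr_sqr ler_wsqrtr// lerDr sqr_ge0.
pose phi := asin (b / r).
have sphi : sin phi = b / r by rewrite asinK// in_itv.
have [p1 p2] : - (pi / 2) <= phi /\ phi <= pi / 2.
  by split; [exact: asin_geNpi2|exact: asin_lepi2].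
have cphi : cos phi = a / r.
  have c0 : 0 <= cos phi by rewrite cos_ge0_pihalf// p1 p2.
  apply/eqP; rewrite -(@eqrXn2 _ 2)//; last by rewrite divr_ge0 ?ltW.
  have -> : cos phi ^+ 2 = 1 - (b / r) ^+ 2.
    by rewrite -sphi -(cos2Dsin2 phi) addrK.
  by rewrite !expr_div_n rr; apply/eqP; field; rewrite gt_eqF.
have pi0 := pi_gt0 R.
have vE : a +i* b = r%:C * (cos phi +i* sin phi).
  by rewrite cphi sphi; simpc; congr (_ +i* _); field.
have v2 : (a +i* b) ^+ 2 = (r ^+ 2 * cos (2 * phi)) +i* (r ^+ 2 * sin (2 * phi)).
  rewrite vE exprMn de_moivre -rmorphXn; simpc.
  by [].
have cm : cmod ((a +i* b) ^+ 2) = r ^+ 2.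
  rewrite v2 /cmod /= !exprMn -mulrDr cos2Dsin2 mulr1 sqrtr_sqr ger0_norm//.
  by rewrite exprn_ge0// ltW.
have sgn_phi : (0 <= phi) = (0 <= b).
  have [phi0|phi0] := ltP phi 0.
    have : 0 < sin (- phi) by apply: sin_gt0_pi; apply/andP; split; lra.
    rewrite sinN sphi oppr_gt0 pmulr_llt0 ?invr_gt0// => b0.
    by rewrite leNgt b0.
  move: phi0; rewrite le_eqVlt => /orP[/eqP phi0|phi0].
    move: sphi; rewrite -phi0 sin0 => /esym/eqP.
    by rewrite mulf_eq0 invr_eq0 (negbTE r_neq0) orbF => /eqP ->; rewrite lexx.
  have : 0 < sin phi by apply: sin_gt0_pi; apply/andP; split; lra.
  by rewrite sphi pmulr_lgt0 ?invr_gt0// => b0; rewrite ltW.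
have ca : carg ((a +i* b) ^+ 2) = 2 * phi.
  have re : complex.Re ((a +i* b) ^+ 2) / r ^+ 2 = cos (2 * phi).
    by rewrite v2 [complex.Re _]/= mulrC mulKf// expf_neq0.
  rewrite /carg cm re.
  have -> : (0 <= complex.Im ((a +i* b) ^+ 2)) = (0 <= b).
    by rewrite expr2 /= [b * a]mulrC -mulr2n pmulrn_lge0// pmulr_rge0.
  rewrite -sgn_phi; case: leP => phi0.
    by rewrite cosK// in_itv /=; apply/andP; split; lra.
  by rewrite cosKN ?opprK//; apply/andP; split; lra.
rewrite /cpow cm ca vE exprMn de_moivre -rmorphXn; congr (_%:C * _).
  by rewrite -(powR_mulrn 2 (ltW r0)) -powRrM mulrCA divff// mulr1 (powR_mulrn _ (ltW r0)).
by rewrite (_ : n%:R / 2 * (2 * phi) = n%:R * phi)//; field.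
Qed.

End PrincipalPower.

Section PoissonRoots.
Variables (R : realType) (n : nat).

(** The real part [c ^+ 2 - d ^+ 2] of the square of [c +i* d] is positive. *)
Lemma sqrtc_right_half (y : R[i]) : 0 < complex.Re y ->
  `|complex.Im (sqrtc y)| < complex.Re (sqrtc y).
Proof.
move=> y0; have := sqr_sqrtc y.
have : 0 <= complex.Re (sqrtc y) by case: (y) => a b; exact: sqrtr_ge0.
case: (sqrtc y) => c d /= c0 e; move: y0; rewrite -e expr2 /= -!expr2 subr_gt0.
by rewrite -[d ^+ 2]real_normK ?num_real// ltr_pXn2r// nnegrE.
Qed.

(** The series sums to the principal power: with [k1 ^+ 2 = 1 - z1] and
    [k2 ^+ 2 = 1 - z2], both square roots having argument less than [pi / 4] in
    modulus, the real part of [k1 * k2] is positive. *)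
Lemma cvg_gsum_cpow (z1 z2 : R[i]) (rho : R) : rho < 1 ->
  `|z1| <= rho%:C -> `|z2| <= rho%:C ->
  (fun N => \sum_(d < N) gsum n d ((z1 + z2) / 2) (z1 * z2) : R[i]^o) @ \oo
    --> ((cpow ((1 - z1) * (1 - z2)) (n%:R / 2))^-1 : R[i]^o).
Proof.
move=> r1 h1 h2.
have Re1 (z : R[i]) : `|z| <= rho%:C -> 0 < complex.Re (1 - z).
  move=> zr; have := le_trans (normc_ge_Re z) zr; rewrite lecR.
  by case: z {zr} => a b /= /ler_normlP[_ h]; lra.
have := sqrtc_right_half (Re1 _ h1); have := sqrtc_right_half (Re1 _ h2).
set k1 := sqrtc (1 - z1); set k2 := sqrtc (1 - z2) => i2 i1.
have k10 : 0 < complex.Re k1 by rewrite (le_lt_trans _ i1).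
have k20 : 0 < complex.Re k2 by rewrite (le_lt_trans _ i2).
have Rv : 0 < complex.Re (k1 * k2).
  move: i1 i2 k10 k20; case: (k1) (k2) => [c1 d1] [c2 d2] /= i1 i2 c10 c20.
  rewrite subr_gt0; apply: le_lt_trans (ler_norm _) _; rewrite normrM.
  by apply: ltr_pM.
have -> : (1 - z1) * (1 - z2) = (k1 * k2) ^+ 2 by rewrite exprMn !sqr_sqrtc.
rewrite (cpow_sqr n Rv).
exact: (cvg_gsum r1 h1 h2 (sqr_sqrtc _) k10 (sqr_sqrtc _) k20).
Qed.

Lemma cdot_rot (e f : R[i]) (b c : n.-tuple R) :
  cdot (e *: embed b) (f *: embed c) = e * f * (\sum_(j < n) tnth b j * tnth c j)%:C.
Proof.
rewrite /cdot rmorph_sum mulr_sumr; apply: eq_bigr => j _.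
by rewrite !mxE rmorphM; ring.
Qed.

Lemma cconj_rot (e : R[i]) (b : n.-tuple R) :
  cconj (e *: embed b) = conjc e *: embed b.
Proof. by apply/rowP => j; rewrite !mxE [LHS]rmorphM; congr (_ * _); exact: conjc_real. Qed.

(** The quadratic [1 - 2 t (x . w) + t ^ 2 (x . x) (w . w)] factors as
    [(1 - z1 t) (1 - z2 t)]. If [x] and [zeta] are the real points [b] and [xi]
    up to phases, [z1] and [z2] are a common rotation of the points
    [d +- i sqrt (beta - d ^ 2)], of modulus [sqrt beta], with [d = b . xi] and
    [beta = |b| ^ 2]; the root is real by the Cauchy-Schwarz inequality. *)
Lemma poisson_roots p x zeta : Bhat R p n x -> Shat R p n zeta ->
  exists z1 z2 : R[i], exists2 rho : R, rho < 1 &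
   [/\ `|z1| <= rho%:C, `|z2| <= rho%:C, cdot x (cconj zeta) = (z1 + z2) / 2 &
       cdot x x * cdot (cconj zeta) (cconj zeta) = z1 * z2].
Proof.
move=> [k kp [b bB ->]] [l lp [xi xiS ->]].
set e1 := Defs.rot R p k; set e2 := conjc (Defs.rot R p l).
pose d := \sum_(j < n) tnth b j * tnth xi j.
pose beta := sqnorm b.
have betaE : \sum_(j < n) tnth b j * tnth b j = beta.
  by apply: eq_bigr => j _; rewrite expr2.
have xi1 : \sum_(j < n) tnth xi j * tnth xi j = 1.
  by rewrite -xiS; apply: eq_bigr => j _; rewrite expr2.
have cs : 0 <= beta - d ^+ 2.
  have -> : beta - d ^+ 2 = \sum_(j < n) (tnth b j - d * tnth xi j) ^+ 2.
    rewrite (eq_bigr (fun j => tnth b j ^+ 2 - 2 * d * (tnth b j * tnth xi j)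
      + d ^+ 2 * (tnth xi j * tnth xi j))) => [|j _]; last by ring.
    rewrite !big_split /= sumrN -!mulr_sumr xi1 -/d -/(sqnorm b) -/beta; ring.
  by apply: sumr_ge0 => j _; exact: sqr_ge0.
have beta0 : 0 <= beta by apply: sumr_ge0 => j _; exact: sqr_ge0.
set g := Num.sqrt (beta - d ^+ 2).
have gg : g ^+ 2 = beta - d ^+ 2 by rewrite sqr_sqrtr.
have rot1 q i : `|Defs.rot R q i| = 1.
  apply/eqP; rewrite -(@eqrXn2 _ 2)// expr1n; apply/eqP.
  by rewrite sqr_normc rot_conj.
have nrm (s : R) : s ^+ 2 = g ^+ 2 -> `|e1 * e2 * (d +i* s)| <= (Num.sqrt beta)%:C.
  move=> sg; rewrite !normrM /e1 /e2 normcJ !rot1 !mul1r normc_def /= lecR.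
  by rewrite sg gg addrC subrK.
exists (e1 * e2 * (d +i* g)), (e1 * e2 * (d +i* (- g))), (Num.sqrt beta).
  by rewrite -sqrtr1 ltr_sqrt.
split; [exact: nrm|by apply: nrm; rewrite sqrrN| |].
  rewrite cconj_rot cdot_rot -/e1 -/e2 -/d -mulrDr.
  have -> : (d +i* g) + (d +i* - g) = 2 * d%:C.
    by apply/eqP; rewrite mulr2n mulrDl mul1r eq_complex /= subrr addr0 !eqxx.
  by field.
rewrite cconj_rot !cdot_rot -/e1 -/e2 betaE xi1 mulr1.
have -> : e1 * e2 * (d +i* g) * (e1 * e2 * (d +i* - g)) =
    e1 * e1 * (e2 * e2) * ((d +i* g) * (d +i* - g)) by ring.
rewrite [in RHS](_ : (d +i* g) * (d +i* - g) = beta%:C); first by ring.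
have -> : beta = d ^+ 2 + g ^+ 2 by rewrite gg addrC subrK.
by apply/eqP; rewrite eq_complex /=; apply/andP; split; apply/eqP; ring.
Qed.

End PoissonRoots.

(** * Gegenbauer terms and the explicit formula *)

Section GegenbauerTerms.
Variables (R : realType) (n : nat).
Hypothesis n1 : (1 < n)%N.

Lemma gsum_half m (s P : R[i]) :
  gsum n m s P =
  \sum_(0 <= k < (m./2).+1) gcoef R[i] n m k * s ^+ (m - 2 * k) * P ^+ k.
Proof.
rewrite /gsum -(big_mkord xpredT (fun k => gcoef R[i] n m k * s ^+ (m - 2 * k) * P ^+ k)).
have mm : (m./2.+1 <= m.+1)%N by lia.
rewrite (big_cat_nat (leq0n _) mm) /= [X in _ + X = _]big_nat_cond.
rewrite [X in _ + X = _]big1 ?addr0// => k.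
by rewrite andbT => /andP[mk _]; rewrite gcoef_gt ?mul0r//; lia.
Qed.

Lemma gegenbauer_coefX l k (s : R[i]) : (2 * k <= l)%N ->
  (gegenbauer_coef (n%:R / 2 : R) l k)%:C * (2 * s) ^+ (l - 2 * k) =
  gcoef R[i] n l k * s ^+ (l - 2 * k).
Proof.
move=> kl; rewrite exprMn mulrA; congr (_ * _).
rewrite -(gcoef_rmorph n (real_complex R)) -(@gegenbauer_coefE R n l k n1 kl).
rewrite [RHS]rmorphM; congr (_ * _); rewrite [RHS]rmorphXn; congr (_ ^+ _).
by rewrite [RHS]rmorph_nat.
Qed.

Lemma cabs_sqr (z : 'rV[R[i]]_n) : cabs z ^+ 2 = cdot z z.
Proof. exact: sqr_sqrtc. Qed.

(** All exponents of [|x| |w|] that remain after cancelling denominators are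
    even, so the two cases in the definition of [gegenbauer_term] agree. *)
Lemma gegenbauer_term_gsum l j (x w : 'rV[R[i]]_n) :
  gegenbauer_term (n%:R / 2) (Posz l) (l + 2 * j) x w =
  (cdot x x * cdot w w) ^+ j * gsum n l (cdot x w) (cdot x x * cdot w w).
Proof.
rewrite gsum_half mulr_sumr /gegenbauer_term; case: eqP => [_|/eqP ab0].
  rewrite !big_mkord; apply: eq_bigr => k _.
  have kl : (2 * k <= l)%N.
    by have := ltn_ord k; lia.
  rewrite gegenbauer_coefX// (_ : ((l + 2 * j - l)./2 = j)%N); last first.
    by rewrite addKn mul2n doubleK.
  by rewrite exprD; ring.
rewrite /gegenbauer -mulrA -exprMn mulr_suml !big_mkord; apply: eq_bigr => k _.
have kl : (2 * k <= l)%N.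
  by have := ltn_ord k; lia.
rewrite gegenbauer_coefX// -!cabs_sqr -exprMn; set c := cabs x * cabs w in ab0 *.
rewrite (_ : (l + 2 * j = (l - 2 * k) + 2 * k + 2 * j)%N); last by rewrite subnK.
rewrite expr_div_n [c ^+ (_ + 2 * j)]exprD [c ^+ (_ + 2 * k)]exprD -!exprM.
by field; rewrite expf_neq0.
Qed.

Lemma gegenbauer_term_neg l m (x w : 'rV[R[i]]_n) :
  gegenbauer_term (n%:R / 2 : R) (Negz l) m x w = 0.
Proof. by rewrite /gegenbauer_term /gegenbauer; case: ifP => _ //; rewrite !mul0r. Qed.

Lemma zsum_gegenbauer p m (x w : 'rV[R[i]]_n) :
  zsum n p m (cdot x w) (cdot x x * cdot w w) =
  gegenbauer_term (n%:R / 2) m%:Z m x w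
  - gegenbauer_term (n%:R / 2) (m%:Z - (2 * p)%:Z) m x w.
Proof.
have := gegenbauer_term_gsum m 0 x w; rewrite muln0 addn0 expr0 mul1r => ->.
rewrite /zsum; congr (_ - _); case: leqP => pm.
  have := gegenbauer_term_gsum (m - 2 * p) p x w; rewrite subnK// => <-.
  by rewrite subzn.
rewrite (_ : m%:Z - (2 * p)%:Z = Negz (2 * p - m).-1) ?gegenbauer_term_neg//.
by lia.
Qed.

(** For [k < p] the second product in the bracket contains the factor 0; for
    [k >= p] it is [2 ^ p * k! / (k - p)!], and both terms have the factor
    [rise (m - p - k)] in common. *)
Lemma gcoef_zonal_coef p m k : (2 * k <= m)%N ->
  gcoef R n m k - (if (2 * p <= m)%N && (p <= k)%N then
                     gcoef R n (m - 2 * p) (k - p) else 0) =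
  (-1) ^+ k * zonal_coef R p n m k / ((k`!)%:R * 2 ^+ k * ((m - 2 * k)`!)%:R).
Proof.
move=> km.
have f0 j : (j`!)%:R != 0 :> R by rewrite pnatr_eq0 -lt0n fact_gt0.
have riseE j : \prod_(0 <= i < j) (n%:R + 2 * i%:R) = rise R n j.
  by rewrite big_mkord.
have riseD j q : rise R n (j + q) =
    rise R n j * \prod_(0 <= i < q) (n%:R + 2 * (j + i)%:R).
  by rewrite big_mkord /rise big_split_ord.
rewrite /zonal_coef !riseE; have [pk|kp] := leqP p k; last first.
  rewrite andbF subr0 /gcoef km [2 ^+ k * _]mulrC; congr (_ * _ / _).
  case: leqP => pmk //.
  rewrite [X in _ - _ * X](_ : _ = 0); last first.
    apply/eqP; rewrite prodf_seq_eq0; apply/hasP.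
    exists (p - 1 - k)%N; first by rewrite mem_index_iota; lia.
    rewrite mulf_eq0; apply/orP; right; apply/eqP.
    by rewrite -subnDA natrB; [rewrite natrD; ring|lia].
  by rewrite mulr0 subr0 -riseD; congr (rise _ _ _); lia.
have pm : (2 * p <= m)%N by lia.
rewrite pm /= ifT; last by lia.
have prodE q j : \prod_(0 <= i < j) (2 * ((q + 1 + i)%:R : R)) =
    2 ^+ j * ((q + j)`!)%:R / (q`!)%:R.
  elim: j => [|j IH]; first by rewrite big_nil addn0 expr0 mul1r divff.
  rewrite big_nat_recr //= IH exprS [(q + j.+1)%N]addnS factS natrM.
  by rewrite (_ : (q + 1 + j = (q + j).+1)%N); [field|lia].
have [q kE] : exists q, k = (q + p)%N by exists (k - p)%N; lia.
have -> : \prod_(0 <= i < p) (2 * (k%:R - p%:R + 1 + i%:R)) =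
    \prod_(0 <= i < p) (2 * ((q + 1 + i)%:R : R)).
  by apply: eq_bigr => i _; rewrite kE !natrD; congr (_ * _); ring.
rewrite prodE /gcoef km ifT; last by lia.
rewrite (_ : (m - 2 * p - (k - p) = m - p - k)%N); last by lia.
rewrite (_ : (m - 2 * p - 2 * (k - p) = m - 2 * k)%N); last by lia.
rewrite (_ : (m - k = (m - p - k) + p)%N) ?riseD; last by lia.
rewrite (_ : (k - p = q)%N); last by lia.
rewrite -kE; have -> : (-1) ^+ q = (-1) ^+ k * (-1) ^+ p :> R.
  by rewrite kE exprD -mulrA -exprMn mulrNN mulr1 expr1n mulr1.
have -> : 2 ^+ k = 2 ^+ q * 2 ^+ p :> R by rewrite kE exprD.
by field; rewrite !f0 !expf_neq0.
Qed.

Lemma zsum_zonal_coef p m (x w : 'rV[R[i]]_n) :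
  zsum n p m (cdot x w) (cdot x x * cdot w w) =
  \sum_(0 <= k < (m./2).+1)
    ((-1) ^+ k * zonal_coef R p n m k
       / ((k`!)%:R * 2 ^+ k * ((m - 2 * k)`!)%:R))%:C
    * cdot x w ^+ (m - 2 * k) * cabs x ^+ (2 * k) * cabs w ^+ (2 * k).
Proof.
set s := cdot x w; set P := cdot x x * cdot w w.
pose a k := if (2 * p <= m)%N && (p <= k)%N then
              gcoef R[i] n (m - 2 * p) (k - p) else 0.
transitivity (\sum_(0 <= k < (m./2).+1)
    (gcoef R[i] n m k - a k) * s ^+ (m - 2 * k) * P ^+ k); last first.
  apply: eq_big_nat => k /andP[_ mk]; have km : (2 * k <= m)%N.
    by lia.
  rewrite -(gcoef_zonal_coef p km) rmorphB /= gcoef_rmorph.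
  have -> : (if (2 * p <= m)%N && (p <= k)%N then
      gcoef R n (m - 2 * p) (k - p) else 0)%:C = a k.
    by rewrite /a; case: ifP => _; [exact: gcoef_rmorph|exact: rmorph0].
  by rewrite -!mulrA !exprM !cabs_sqr -exprMn.
under [RHS]eq_bigr do rewrite !mulrBl.
rewrite big_split sumrN /= -gsum_half; congr (_ - _).
case: ifP => [pm|pm]; last first.
  by rewrite big1// => k _; rewrite /a pm !mul0r.
have pk : (p <= (m./2).+1)%N by lia.
rewrite (big_cat_nat (leq0n _) pk) /= big_nat_cond big1 ?add0r => [|k /andP[/andP[_ kp] _]].
  have shift N (f : nat -> R[i]) :
      \sum_(p <= i < N) f i = \sum_(0 <= i < N - p) f (i + p)%N.
    by rewrite -{1}[p]add0n big_addn.
  rewrite shift gsum_half mulr_sumr.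
  rewrite (_ : ((m./2).+1 - p = (m - 2 * p)./2.+1)%N); last by lia.
  apply: eq_big_nat => k _; rewrite /a pm leq_addl addnK exprD /=.
  rewrite (_ : (m - 2 * (k + p) = m - 2 * p - 2 * k)%N); last by lia.
  by ring.
by rewrite /a [(p <= k)%N]leqNgt kp andbF !mul0r.
Qed.

End GegenbauerTerms.

Theorem theorem6 (R : realType) (p n m : nat) (hp : (1 <= p)%N) (hn : (2 <= n)%N)
    (zeta : 'rV[R[i]]_n) (hzeta : Shat R p n zeta) :
  (forall x : 'rV[R[i]]_n, Bhat R p n x ->
     let u := fun d : nat =>
       gegenbauer_term (n%:R / 2%:R) d%:Z d x (cconj zeta) : R[i]^o in
     cvgn (series u) /\
     poisson p x zeta = (1 - cabs x ^+ (2 * p)) * limn (series u)) /\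
  (forall x : 'rV[R[i]]_n,
     zonal p m x zeta =
       gegenbauer_term (n%:R / 2%:R) m%:Z m x (cconj zeta)
       - gegenbauer_term (n%:R / 2%:R) (m%:Z - (2 * p)%:Z) m x (cconj zeta)) /\
  (forall x : 'rV[R[i]]_n,
     zonal p m x zeta =
       \sum_(0 <= k < (m./2).+1)
         ((-1) ^+ k * zonal_coef R p n m k
          / ((k`!)%:R * 2%:R ^+ k * ((m - 2 * k)`!)%:R))%:C
         * cdot x (cconj zeta) ^+ (m - 2 * k)
         * cabs x ^+ (2 * k) * cabs (cconj zeta) ^+ (2 * k)).
Proof.
have n0 : (0 < n)%N by exact: ltn_trans hn.
split; [|split] => x.
- move=> hx u.
  have [z1 [z2 [rho r1 [h1 h2 sE PE]]]] := poisson_roots hx hzeta.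
  have uE : series u = fun N => \sum_(d < N) gsum n d ((z1 + z2) / 2) (z1 * z2).
    apply/funext => N; rewrite /series /= big_mkord; apply: eq_bigr => d _.
    have := gegenbauer_term_gsum hn d 0 x (cconj zeta).
    by rewrite muln0 addn0 expr0 mul1r sE PE.
  have cu := @cvg_gsum_cpow R n z1 z2 rho r1 h1 h2; rewrite -uE in cu.
  split; first by apply/cvg_ex; eexists; exact: cu.
  have -> : limn (series u) = (cpow ((1 - z1) * (1 - z2)) (n%:R / 2))^-1.
    by apply: cvg_lim => //; exact: norm_hausdorff.
  by rewrite /poisson PE sE; congr (_ / cpow _ _); field.
- by rewrite (zonalE hp n0 m x hzeta) (zsum_gegenbauer hn).
- by rewrite (zonalE hp n0 m x hzeta) (zsum_zonal_coef hn).
Qed.
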